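(* Let $G=(V,E)$ be a minimally $(r,Q)$-connected graph with $R,Q\subseteq V$, $Q\cup R=V$, and $r_{uv}\in\{0,1,2\}$ for all $u,v\in R$. Then every $R$-component of $G$ is a tree. Furthermore, for any subset $\mathcal{C}$ of connected components of $G\setminus R$, replacing, for each $C\in\mathcal{C}$, the corresponding tree (the $R$-component of $C$) by a DFS cycle on $\Gamma_G(C)$ of capacity $1/2$ results in a fractionally $(r,Q)$-connected graph.
   Context: $\lambda^Q_G(u,v)$ is the maximum number of $uv$-paths pairwise disjoint in edges and in nodes of $Q\setminus\{u,v\}$; $G$ is $(r,Q)$-connected if $\lambda^Q_G(u,v)\ge r_{uv}$ for all $u,v\in R$ with $r_{uv}>0$, and minimally so if no proper subgraph of $G$ is $(r,Q)$-connected. For $C\subseteq V$, $\Gamma_G(C)$ is the set of neighbors of $C$ outside $C$, $\delta_G(C)$ the edges with exactly one endnode in $C$, $E(C)$ the edges with both endnodes in $C$. For a connected component $C$ of $G\setminus R$, its $R$-component is the subgraph with node set $C\cup\Gamma_G(C)$ and edge set $E(C)\cup\delta_G(C)$. For a tree $T$ with leaf set $L$, a DFS cycle on $L$ is the cycle on $L$ visiting the leaves in the order in which a depth-first traversal of $T$ visits them. A biset is $\hat Y=(Y,Y^+)$ with $Y\subseteq Y^+\subseteq V$, $\Gamma(\hat Y)=Y^+\setminus Y$; an edge covers $\hat Y$ if one endnode is in $Y$ and the other in $V\setminus Y^+$. Let $f(\hat Y)=\max\{r_{uv}: uv$ covers $\hat Y, r_{uv}>0\}-|\Gamma(\hat Y)|$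 if $\Gamma(\hat Y)\subseteq Q$, and $0$ otherwise. A graph with edge capacities $x_e\in[0,1]$ (original edges having capacity $1$) is fractionally $(r,Q)$-connected if for every biset $\hat Y$ the total capacity of edges covering $\hat Y$ is at least $f(\hat Y)$. *)

(* Defs.v *)
From HB Require Import structures.
From mathcomp Require Import all_boot all_order all_algebra.

Set Implicit Arguments.
Unset Strict Implicit.
Unset Printing Implicit Defensive.

Import Order.TTheory GRing.Theory Num.Theory.

(* Loopless finite multigraphs.  Nodes and edges are drawn from finite ambient
   types T and E, and an ambient incidence function [ends : E -> {set T}] gives
   the endnodes of each edge; a graph is a node set together with an edge set,
   so that a subgraph is again a graph for the same [ends]. *)
Record graph (T E : finType) := Graph { nodes : {set T}; edges : {set E} }.

Section Graphs.

Variables (T E : finType) (ends : E -> {set T}).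
Implicit Types (G H : graph T E) (C R Q : {set T}) (r : T -> T -> nat).

Definition well_formed G : bool :=
  [forall e in edges G, (#|ends e| == 2) && (ends e \subset nodes G)].

Definition adj G : rel T :=
  fun x y => [exists e in edges G, ends e == [set x; y]].

(* A walk from x is the list of its successive (edge, next node) steps. *)
Fixpoint walk G (x : T) (p : seq (E * T)) : bool :=
  if p is (e, y) :: p' then
    [&& e \in edges G, ends e == [set x; y] & walk G y p']
  else x \in nodes G.

Definition is_uvpath G (u v : T) (p : seq (E * T)) : bool :=
  [&& walk G u p, last u (unzip2 p) == v & uniq (u :: unzip2 p)].

(* Two parallel edges form a cycle of length 2. *)
Definition is_cycle G (x : T) (p : seq (E * T)) : bool :=
  [&& p != [::], walk G x p, last x (unzip2 p) == x,
      uniq (unzip1 p) & uniq (unzip2 p)].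

Definition connected G : Prop :=
  nodes G != set0 /\ {in nodes G &, forall x y, connect (adj G) x y}.

Definition is_tree G : Prop :=
  connected G /\ forall x p, ~~ is_cycle G x p.

(* Disjointness of two uv-paths in edges and in nodes of Q \ {u, v}. *)
Definition Qdisjoint Q (u v : T) (p q : seq (E * T)) : bool :=
  ~~ has (mem (unzip1 p)) (unzip1 q) &&
  ~~ has [pred x in unzip2 p | x \in Q :\: [set u; v]] (unzip2 q).

(* A path has at most #|T| nodes, so bounded sequences contain all paths. *)
Definition Qlambda Q G (u v : T) : nat :=
  \max_(P : {set {bseq #|T| of E * T}} |
          [forall p in P, is_uvpath G u v (p : {bseq #|T| of E * T})] &&
          [forall p in P, forall q in P, (p != q) ==> Qdisjoint Q u v p q])
     #|P|.

Definition rQ_connected r R Q G : Prop :=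
  forall u v, u \in R -> v \in R -> u != v -> r u v > 0 ->
    r u v <= Qlambda Q G u v.

Definition proper_subgraph H G : Prop :=
  [/\ well_formed H, nodes H \subset nodes G, edges H \subset edges G
    & H <> G].

Definition minimally_rQ_connected r R Q G : Prop :=
  rQ_connected r R Q G /\
  forall H, proper_subgraph H G -> ~ rQ_connected r R Q H.

Definition graphD G R : graph T E :=
  Graph (nodes G :\: R) [set e in edges G | [disjoint ends e & R]].

Definition components G : {set {set T}} :=
  [set [set y in nodes G | connect (adj G) x y] | x in nodes G].

Definition neighbors G C : {set T} :=
  [set y in nodes G :\: C | [exists x in C, adj G x y]].

Definition cut_edges G C : {set E} :=
  [set e in edges G | #|ends e :&: C| == 1].

Definition inner_edges G C : {set E} :=
  [set e in edges G | ends e \subset C].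

Definition Rcomponent G C : graph T E :=
  Graph (C :|: neighbors G C) (inner_edges G C :|: cut_edges G C).

(* [s] lists L in the order in which a depth-first traversal of the tree G
   visits it (L is meant to be the leaf set of G; in a minimally connected
   graph the leaf set of an R-component is [neighbors G C]); the cycle on L
   then joins each x to [next s x].  The traversal
   starts at any node [root] and explores neighbors in the order given by any
   adjacency lists [g]; [dfs] returns the visited nodes last-visited first. *)
Definition dfs_cycle G (L : {set T}) (s : seq T) : Prop :=
  exists (g : T -> seq T) (root : T),
    [/\ forall x y, (y \in g x) = adj G x y,
        root \in nodes G
      & s = [seq x <- rev (dfs g #|T| [::] root) | x \in L]].

End Graphs.

Section Bisets.

Variables (T : finType).
Implicit Types (W Y Yp R Q : {set T}) (r : T -> T -> nat).

(* W is the node set of the graph, and S the set of endnodes of an edge. *)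
Definition covers W Y Yp (S : {set T}) : bool :=
  [exists x in Y, exists y in W :\: Yp, S == [set x; y]].

(* With the convention that the maximum of the empty set is 0, an uncovered
   biset has a requirement of at most 0, i.e. imposes no constraint. *)
Definition biset_max r R W Y Yp : nat :=
  \max_(uv : T * T | [&& uv.1 \in R, uv.2 \in R,
                         covers W Y Yp [set uv.1; uv.2]
                       & 0 < r uv.1 uv.2]) r uv.1 uv.2.

Definition biset_req r R Q W Y Yp : rat :=
  if Yp :\: Y \subset Q then
    ((biset_max r R W Y Yp)%:R - #|Yp :\: Y|%:R)%R
  else 0%R.

Definition frac_rQ_connected (E : finType) (ends : E -> {set T})
    (x : E -> rat) r R Q (G : graph T E) : Prop :=
  (forall e, e \in edges G -> (0 <= x e <= 1)%R) /\
  forall Y Yp, Y \subset Yp -> Yp \subset nodes G ->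
    (biset_req r R Q (nodes G) Y Yp <=
     \sum_(e in edges G | covers (nodes G) Y Yp (ends e)) x e)%R.

End Bisets.

(* Replacing, for each C in CC, the R-component of C by the cycle that visits
   [neighbors G C] in the cyclic order [s C].  The edges of the new graph are
   the remaining edges [inl e] and, for each C in CC and x in [neighbors G C],
   the edge [inr (C, x)] joining x to its successor; thus a cycle on two nodes
   consists of two parallel edges.  The nodes of C disappear. *)
Section Replace.

Variables (T E : finType) (ends : E -> {set T}) (G : graph T E).
Variables (CC : {set {set T}}) (s : {set T} -> seq T).

Definition repl_edge : finType := (E + {set T} * T)%type.

Definition repl_ends (e : repl_edge) : {set T} :=
  match e with
  | inl e0 => ends e0
  | inr (C, x) => [set x; next (s C) x]
  end.

Definition repl_cap (e : repl_edge) : rat :=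
  match e with
  | inl _ => 1%R
  | inr _ => (1 / 2%:R)%R
  end.

Definition repl_graph : graph T repl_edge :=
  Graph (nodes G :\: cover CC)
    [set e : repl_edge |
      match e with
      | inl e0 => (e0 \in edges G) &&
          [forall C in CC, e0 \notin edges (Rcomponent ends G C)]
      | inr (C, x) => (C \in CC) && (x \in neighbors ends G C)
      end].

End Replace.

(* Main.v *)
Require Import Defs.
From HB Require Import structures.
From mathcomp Require Import all_boot all_order all_algebra zify.

Set Implicit Arguments.
Unset Strict Implicit.
Unset Printing Implicit Defensive.

Import Order.TTheory GRing.Theory Num.Theory.

(* In a minimal G every edge e lies in a tight cut: for some pair u, v with
   r u v = 2, all other edges of the cut are met by a single breaker, which is
   an edge or a node of Q (or e is a bridge).  The key fact is that G has no
   trail through Q \ R that is closed or whose ends stay 2-connected off the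
   trail.  Indeed the breaker of an edge of such a trail must lie on the trail,
   so it may be taken to be a node.  The breaker of the first edge comes later
   on the trail; if that of the i-th edge comes later but that of the next edge
   comes earlier, then uncrossing the two cuts gives the next edge a later
   breaker after all, or a single node of Q separating a pair with r u v = 2.
   But the last edge has no later breaker.
   A cycle of an R-component yields a closed trail, so R-components are trees.
   Two disjoint uv-paths cannot both meet the same component C, since a shortest
   connection inside C would be such a trail; nor can one of them pass through
   Gamma(C) at z in Q while the other meets C.  So the two paths cross a biset
   at different edges or cycles, and each cycle crossed has capacity at least 1,
   or 1/2 if its nodes include the node of Gamma(Y).  The order in which a cycle
   visits Gamma(C) is irrelevant for this. *)

(** * Preliminaries *)

Lemma disjoint_setUU (X : finType) (A A' B B' : {set X}) :
  [disjoint A & B] -> [disjoint A & B'] -> [disjoint A' & B] ->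
  [disjoint A' & B'] ->
  [disjoint A :|: A' & B :|: B'].
Proof. by rewrite -!setI_eq0 setIUl !setIUr !setU_eq0 => -> -> -> ->. Qed.

Lemma ler_sum_sub (K : numDomainType) (I : finType) (A B : {pred I})
    (F : I -> K) :
  {subset A <= B} -> (forall i, 0 <= F i)%R ->
  (\sum_(i in A) F i <= \sum_(i in B) F i)%R.
Proof.
move=> AB F_ge0; rewrite [leRHS](bigID [in A]) /=.
rewrite [X in (_ <= X + _)%R](eq_bigl [in A]); first by rewrite lerDl sumr_ge0.
by move=> i; rewrite andbC; apply: andb_idr; apply: AB.
Qed.

Lemma next_exit (X : finType) (s : seq X) (P : pred X) a b :
  uniq s -> a \in s -> b \in s -> P a -> ~~ P b ->
  exists x, [/\ x \in s, P x & ~~ P (next s x)].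
Proof.
move=> us as_ bs Pa nPb.
have : fconnect (next s) a b by rewrite (fconnect_cycle (cycle_next us)).
case/connectP=> p pp lb; rewrite {b bs}lb in nPb.
elim: p a as_ Pa pp nPb => [|y p IH] a as_ Pa /=; first by rewrite Pa.
case/andP=> /eqP<- pp nPb; have [Py|nPy] := boolP (P (next s a)).
  by apply: (IH (next s a)); rewrite ?mem_next.
by exists a.
Qed.

Lemma dfs_uniq (T : finType) (g : T -> seq T) n v x :
  uniq v -> uniq (dfs g n v x).
Proof.
elim: n v x => [|n IHn] v x uv /=; first by case: ifP.
case: ifPn => // xv; have : uniq (x :: v) by rewrite /= xv.
by elim: (g x) (x :: v) => //= y a IHa v' uv'; apply/IHa/IHn.
Qed.

(** * Menger's theorem *)

Section Transversal.

Variable X : finType.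
Implicit Types (D U : {set X}) (F : {set {set X}}) (P : {set X} -> X -> bool).

(* Each member of F picks a point of D, and by counting every point of D is
   picked exactly once, so that F can be indexed by D through pblock. *)
Lemma trivIset_transversal F D P : trivIset F -> #|D| <= #|F| ->
  {in F, forall U, exists2 d, d \in D :&: U & P U d} ->
  [/\ #|D| = #|F|, {in D, forall d, P (pblock F d) d},
      {in D &, forall c d, c != d -> [disjoint pblock F c & pblock F d]}
    & {in D, forall d, pblock F d :&: D = [set d]}].
Proof.
move=> tF leDF meetD.
have /fin_all_exists2[f fDU fP] : forall U : {U | U \in F},
    exists2 d, d \in D :&: val U & P (val U) d by case=> U; apply: meetD.
have blockE i : pblock F (f i) = val i.
  by apply: def_pblock (valP i) _ => //; case/setIP: (fDU i).
have f_inj : injective f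
  by move=> i j fij; apply: val_inj; rewrite -!blockE fij.
have card_f : #|f @: setT| = #|F|.
  by rewrite card_imset // cardsT card_sig; apply: eq_card.
have fD : f @: setT = D.
  apply/eqP; rewrite eqEcard card_f leDF andbT;
    apply/subsetP=> _ /imsetP[i _ ->].
  by case/setIP: (fDU i).
have D_f d : d \in D -> exists i, d = f i.
  by rewrite -fD => /imsetP[i _ ->]; exists i.
split=> [|d /D_f[i ->]|c d /D_f[i ->] /D_f[j ->] nij|d /D_f[i ->]];
  rewrite ?blockE //.
- by rewrite -card_f fD.
- apply: (trivIsetP tF); [exact: valP | exact: valP |].
  by apply: contraNneq nij => /val_inj->.
- apply/setP=> c; rewrite !inE; apply/andP/eqP=> [[ci /D_f[j cj]]|->].
    rewrite cj in ci *; congr f; apply: val_inj.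
    by rewrite -blockE (def_pblock tF (valP i)).
  by case/setIP: (fDU i).
Qed.

End Transversal.

Section Linked.

Variable X : finType.
Implicit Types (e : rel X) (A B D S U : {set X}).

Definition linked e U A B :=
  [exists a in A :&: U, exists b in B, connect [rel x y in U | e x y] a b].

Lemma linkedP e U A B :
  reflect (exists a p,
    [/\ a \in A, last a p \in B, all [in U] (a :: p) & path e a p])
          (linked e U A B).
Proof.
have path_in a p : a \in U ->
    path [rel x y in U | e x y] a p = all [in U] p && path e a p.
  elim: p a => //= b p IH a aU; rewrite aU /=; have [bU|//] := boolP (b \in U).
  by rewrite IH //= andbCA.
apply: (iffP exists_inP) => [[a /setIP[aA aU] /exists_inP[b bB /connectP[p]]]|].
  by rewrite path_in // => /andP[pU pe] lp; exists a, p; rewrite -lp /= aU.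
case=> a [p [aA lB /andP[aU pU] pe]]; exists a; first by rewrite inE aA.
apply/exists_inP; exists (last a p) => //; apply/connectP; exists p => //.
by rewrite path_in //; apply/andP.
Qed.

Lemma sub_linked e e' U U' A B :
  subrel e e' -> U \subset U' -> linked e U A B -> linked e' U' A B.
Proof.
move=> see' /subsetP sUU' /linkedP[a [p [aA lB apU pe]]]; apply/linkedP;
  exists a, p.
by split=> //; [apply: sub_all apU | apply: sub_path pe].
Qed.

Lemma linked_rev e U A B : linked (fun x y => e y x) U A B = linked e U B A.
Proof.
have rev_linked f C D : linked f U C D -> linked (fun x y => f y x) U D C.
  case/linkedP=> a [p [aC lD apU pf]]; apply/linkedP.
  exists (last a p), (rev (belast a p)); split=> //.
  - by case: (p) => //= b q; rewrite rev_cons last_rcons.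
  - have -> : last a p :: rev (belast a p) = rev (a :: p)
      by rewrite -rev_rcons -lastI.
    by rewrite all_rev.
  - by rewrite rev_path.
by apply/idP/idP=> /rev_linked.
Qed.

Lemma linked_refl e U A B a : a \in U -> a \in A -> a \in B -> linked e U A B.
Proof. by move=> aU aA aB; apply/linkedP; exists a, [::]; rewrite /= aU. Qed.

Lemma linked_cons e U A B a b :
  a \in U -> a \in A -> e a b -> linked e U [set b] B -> linked e U A B.
Proof.
move=> aU aA eab /linkedP[_ [p [/set1P-> lB bpU pe]]].
by apply/linkedP; exists a, (b :: p); rewrite /= aU eab.
Qed.

Lemma linked_cat e U U' A B x y : linked e U A [set x] ->
  (x == y) || e x y -> linked e U' [set y] B -> linked e (U :|: U') A B.
Proof.
move=> /linkedP[a [p [aA /set1P lp apU pe]]] xy yB.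
have {}yB : linked e (U :|: U') [set y] B
  by apply: sub_linked yB; rewrite // subsetUr.
elim: p a A aA lp apU pe => [|b p IH] a A aA /= lp /andP[aU bpU].
  have aUU' : a \in U :|: U' by rewrite inE aU.
  rewrite -lp in xy; case/predU1P: xy => [ay|eay] _; last first.
    exact: (linked_cons aUU' aA eay yB).
  case/linkedP: yB => _ [q [/set1P-> lB yqU qe]]; apply/linkedP.
  by exists y, q; rewrite -{1}ay.
case/andP=> eab pe; apply: (@linked_cons _ _ _ _ a b) => //;
  first by rewrite inE aU.
exact: (IH b [set b] (set11 b)).
Qed.

Lemma linked_rcons e U A x y :
  linked e U A [set x] -> e x y -> y \in U -> linked e U A [set y].
Proof.
move=> Ax exy yU; rewrite -[U]setUid (linked_cat Ax (y := y)) ?exy ?orbT //.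
exact: linked_refl yU (set11 y) (set11 y).
Qed.

Lemma linked_target e U A B :
  linked e U A B -> exists2 b, b \in B :&: U & linked e U A [set b].
Proof.
case/linkedP=> a [p [aA lB apU pe]]; exists (last a p).
  by rewrite inE lB; apply: (allP apU); apply: mem_last.
by apply/linkedP; exists a, p; rewrite inE eqxx.
Qed.

Lemma linked_neq0 e U A B : linked e U A B -> U != set0.
Proof. by case/linked_target=> b /setIP[_ bU] _; apply/set0Pn; exists b. Qed.

Lemma linked_source e U A B :
  linked e U A B -> exists2 a, a \in A :&: U & linked e U [set a] B.
Proof.
by rewrite -linked_rev => /linked_target[a aAU]; rewrite linked_rev; exists a.
Qed.

Lemma linked_first_hit e e' U A B D :
  (forall x y, e x y -> x \notin D -> e' x y) ->
  linked e U A B -> linked e' U A D || linked e' (U :\: D) A B.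
Proof.
move=> ee' /linkedP[a [p [aA lB apU pe]]].
elim: p a A aA lB apU pe => [|b p IH] a A aA /= lB /andP[aU bpU].
  move=> _; have [aD|aD] := boolP (a \in D);
    first by rewrite (@linked_refl _ _ _ _ a).
  by rewrite orbC (@linked_refl _ _ _ _ a) // inE aD.
case/andP=> eab pe; have [aD|aD] := boolP (a \in D).
  by rewrite (@linked_refl _ _ _ _ a).
have {}eab := ee' _ _ eab aD.
have /orP[bD|bB] := IH b [set b] (set11 b) lB bpU pe.
  by rewrite (linked_cons aU aA eab bD).
by rewrite orbC (@linked_cons _ _ _ _ a b) // inE aD.
Qed.

Definition side e A S := S :|: [set b | linked e (~: S) A [set b]].

Lemma sideI e A B S b : ~~ linked e (~: S) A B ->
  b \in side e A S -> b \in side (fun x y => e y x) B S -> b \in S.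
Proof.
move=> nAB; rewrite !inE => /orP[//|Ab] /orP[//|]; rewrite linked_rev => bB.
by case/negP: nAB; rewrite -[~: S]setUid (linked_cat Ab _ bB) ?eqxx.
Qed.

Lemma linked_side e U A S z : U :&: S \subset [set z] ->
  linked e U A [set z] -> linked e (U :&: side e A S) A [set z].
Proof.
move=> /subsetP USz /linkedP[a [p [aA /set1P lp apU pe]]].
have aS : a \in side e A S.
  rewrite !inE; have [//|aS] := boolP (a \in S).
  by rewrite (@linked_refl _ _ _ _ a) ?inE.
suff: linked e (U :&: side e A S) [set a] [set z].
  move=> /linkedP[_ [q [/set1P-> lq aqU qe]]]; apply/linkedP; exists a, q.
  by split.
elim: p a aS lp apU pe {aA} => [|b p IH] a aS /= lp /andP[aU bpU];
  have aUside : a \in U :&: side e A S by rewrite in_setI aU.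
  by move=> _; apply: (linked_refl _ aUside); rewrite ?set11 // lp set11.
case/andP=> eab pe; have [aiS|aiS] := boolP (a \in S).
  by apply: (linked_refl _ aUside); rewrite ?set11 // USz // inE aU.
apply: (linked_cons aUside (set11 a) eab).
apply: IH => //; move: aS; rewrite !inE (negPf aiS) /=.
have [//|biS] := boolP (b \in S) => Aa.
by apply: linked_rcons Aa eab _; rewrite inE.
Qed.

End Linked.

Section Glue.

Variables (X : finType) (e e' : rel X) (A B S : {set X}) (x y : X).
Variables (f h : X -> {set X}).
Hypotheses (sub_e'e : subrel e' e) (exy : e x y) (yS : y \notin S).
Hypothesis separated : ~~ linked e' (~: S) A B.
Hypothesis f_linked : {in x |: S, forall c, linked e' (f c) A [set c]}.
Hypothesis h_linked : {in y |: S, forall c, linked e' (h c) [set c] B}.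
Hypothesis f_disjoint :
  {in x |: S &, forall c d, c != d -> [disjoint f c & f d]}.
Hypothesis h_disjoint :
  {in y |: S &, forall c d, c != d -> [disjoint h c & h d]}.
Hypothesis f_meet : {in x |: S, forall c, f c :&: (x |: S) = [set c]}.
Hypothesis h_meet : {in y |: S, forall c, h c :&: (y |: S) = [set c]}.

Definition glue_end c := if c == x then y else c.

Lemma glue_end_in c : c \in x |: S -> glue_end c \in y |: S.
Proof.
rewrite /glue_end; have [_ _|ncx] := eqVneq c x; first exact: setU11.
by rewrite !in_setU1 (negPf ncx) /= orbC => ->.
Qed.

Lemma glue_end_inj : {in x |: S &, injective glue_end}.
Proof.
move=> c d; rewrite /glue_end !in_setU1.
have [->|ncx] := eqVneq c x; have [->|ndx] := eqVneq d x => //= cS dS Ecd.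
  by case/negP: yS; rewrite Ecd.
by case/negP: yS; rewrite -Ecd.
Qed.

Definition glued c := (f c :&: side e' A S)
  :|: (h (glue_end c) :&: side (fun a b => e' b a) B S).

Lemma glued_cross_disjoint c d : c \in x |: S -> d \in x |: S -> c != d ->
  [disjoint f c :&: side e' A S
    & h (glue_end d) :&: side (fun a b => e' b a) B S].
Proof.
move=> cD dD ncd; apply/pred0P=> b;
  apply/negP=> /andP[/setIP[bf bA] /setIP[bh bB]].
have bS := sideI separated bA bB.
have bc : b \in [set c] by rewrite -f_meet // inE bf in_setU1 bS orbT.
have bd : b \in [set glue_end d].
  by rewrite -h_meet ?glue_end_in // inE bh in_setU1 bS orbT.
move/set1P: bc => bc; move: bd bS ncd; rewrite -bc inE /glue_end.
by have [_ /eqP->|_ /eqP->] := eqVneq d x; [rewrite (negPf yS) | rewrite eqxx].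
Qed.

Lemma glued_disjoint :
  {in x |: S &, forall c d, d != c -> [disjoint glued c & glued d]}.
Proof.
move=> c d cD dD ndc; have ncd : c != d by rewrite eq_sym.
have ne : glue_end c != glue_end d
  by apply: contra_neq ncd; apply: glue_end_inj.
apply: disjoint_setUU.
- by apply: disjointW (f_disjoint cD dD ncd); rewrite subsetIl.
- exact: glued_cross_disjoint.
- by rewrite disjoint_sym glued_cross_disjoint.
- by apply: disjointW (h_disjoint (glue_end_in cD) (glue_end_in dD) ne);
    rewrite subsetIl.
Qed.

Lemma glued_linked : {in x |: S, forall c, linked e (glued c) A B}.
Proof.
move=> c cD; have tD := glue_end_in cD;
  apply: (@linked_cat _ _ _ _ _ _ c (glue_end c)).
- apply: (sub_linked sub_e'e (subxx _)); apply: linked_side (f_linked cD).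
  by rewrite -(f_meet cD) setIS // subsetUr.
- by rewrite /glue_end; have [->|_] := eqVneq c x; rewrite ?exy ?orbT ?eqxx.
- apply: (sub_linked sub_e'e (subxx _)); rewrite -linked_rev;
    apply: linked_side.
    by rewrite -(h_meet tD) setIS // subsetUr.
  by rewrite linked_rev h_linked.
Qed.

Lemma glued_family : exists F : {set {set X}},
  [/\ trivIset F, #|F| = #|x |: S| & {in F, forall U, linked e U A B}].
Proof.
have [|tF glued_inj] := trivIimset glued_disjoint.
  by apply/imsetP=> -[c cD W0]; have := linked_neq0 (glued_linked cD);
    rewrite -W0 eqxx.
exists (glued @: (x |: S)); split=> // [|U /imsetP[c cD ->]];
  last exact: glued_linked.
by rewrite card_in_imset.
Qed.

End Glue.

Section Menger.

Variable X : finType.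
Implicit Types (e : rel X) (A B S U : {set X}) (F H : {set {set X}}).

Lemma menger_glue e e' A B S x y F H k :
  subrel e' e -> e x y -> ~~ linked e' (~: S) A B -> #|S| < k ->
  trivIset F -> k <= #|F| -> {in F, forall U, linked e' U A (x |: S)} ->
  trivIset H -> k <= #|H| -> {in H, forall U, linked e' U (y |: S) B} ->
  exists F', [/\ trivIset F', k <= #|F'| & {in F', forall U, linked e U A B}].
Proof.
move=> see' exy nAB ltS tF leF linkF tH leH linkH.
have card_le z (K : {set {set X}}) : k <= #|K| -> #|z |: S| <= #|K|.
  by move=> leK; rewrite cardsU1; apply: leq_trans leK; case: (_ \notin _); lia.
have [cardF f_linked f_disjoint f_meet] :=
  trivIset_transversal tF (card_le x F leF)
  (fun U UF => linked_target (linkF U UF)).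
have [cardH h_linked h_disjoint h_meet] := trivIset_transversal
  (P := fun U d => linked e' U [set d] B) tH (card_le y H leH)
  (fun U UH => linked_source (linkH U UH)).
have yS : y \notin S.
  by move: leH; rewrite -cardH cardsU1; case: (y \in S) => //; lia.
have [F' [tF' cardF' linkF']] := glued_family see' exy yS nAB
  f_linked h_linked f_disjoint h_disjoint f_meet h_meet.
by exists F'; rewrite cardF' cardF.
Qed.

Lemma trivIset_singletons (A : {set X}) :
  trivIset (set1 @: A) /\ #|set1 @: A| = #|A|.
Proof.
split; last by rewrite card_imset //; apply: set1_inj.
apply/trivIsetP=> _ _ /imsetP[a _ ->] /imsetP[b _ ->] nab.
by rewrite disjoints1 inE; apply: contra_neq nab => ->.
Qed.

(* Goering's induction on the number of arcs: if deleting the arc (x, y) lets a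
   set S of fewer than k vertices separate A from B, then k disjoint paths from
   A to x |: S and from y |: S to B are glued at S and along the arc. *)
Theorem menger e A B k : (forall S, #|S| < k -> linked e (~: S) A B) ->
  exists F, [/\ trivIset F, k <= #|F| & {in F, forall U, linked e U A B}].
Proof.
have [n] := ubnP #|[set p : X * X | e p.1 p.2]|.
elim: n e A B => // n IHn e A B le_n linkS.
have [[x y] /= exy|no_arc] := pickP [pred p : X * X | e p.1 p.2]; last first.
  have [tF cardF] := trivIset_singletons (A :&: B).
  exists (set1 @: (A :&: B)); split=> // [|_ /imsetP[a /setIP[aA aB] ->]];
    last first.
    exact: linked_refl (set11 a) aA aB.
  rewrite cardF leqNgt; apply/negP=> /linkS/linkedP[a [[|b p] [aA aB]]] /=.
    by rewrite !inE aA aB.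
  by have := no_arc (a, b) => /= ->.
pose e' : rel X := [rel a b | e a b && ((a, b) != (x, y))].
have see' : subrel e' e by move=> a b /andP[].
have lt_n : #|[set p : X * X | e' p.1 p.2]| < n.
  rewrite -ltnS; apply: leq_trans le_n; rewrite ltnS; apply: proper_card.
  apply/properP; split; first by apply/subsetP=> p; rewrite !inE; apply: see'.
  by exists (x, y); rewrite !inE //= /e' /= eqxx andbF.
have [/forallP link'|] :=
  boolP [forall S : {set X}, (#|S| < k) ==> linked e' (~: S) A B].
  have [|F [tF leF linkF]] := IHn e' A B lt_n; first by move=> S; apply/implyP.
  by exists F; split=> // U UF; apply: sub_linked (linkF U UF).
rewrite negb_forall => /existsP[S]; rewrite negb_imply => /andP[ltS nlink].
have nlink_sub z (D : {set X}) : ~~ linked e' (~: D :\: (z |: S)) A B.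
  apply: contra nlink; apply: sub_linked => //; apply/subsetP=> a.
  by rewrite !inE negb_or -andbA => /and3P[].
have [D ltD|F [tF leF linkF]] := IHn e' A (x |: S) lt_n.
  have := linked_first_hit (e' := e') (D := x |: S) _ (linkS D ltD).
  rewrite (negPf (nlink_sub _ _)) orbF; apply=> a b /= eab.
  by rewrite in_setU1 => /norP[nax _]; rewrite /e' /= eab xpair_eqE (negPf nax).
have [D ltD|H [tH leH linkH]] := IHn e' (y |: S) B lt_n.
  have := linkS D ltD; rewrite -!(linked_rev _ _ B).
  move/(linked_first_hit (e' := fun a b => e' b a) (D := y |: S)).
  rewrite linked_rev (linked_rev e') (negPf (nlink_sub _ _)) orbF;
    apply=> a b /= eab.
  by rewrite in_setU1 => /norP[nay _];
    rewrite /e' /= eab xpair_eqE (negPf nay) andbF.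
exact: (menger_glue see' exy nlink ltS tF leF linkF tH leH linkH).
Qed.

End Menger.

(** * Walks and cuts *)

Section Graphs.

Variables (T E : finType) (ends : E -> {set T}).
Implicit Types (G H : graph T E) (S : {set T}) (x y z : T) (e g : E).
Implicit Types (p q : seq (E * T)).

Lemma wf_ends G e : well_formed ends G -> e \in edges G ->
  exists x y, [/\ ends e = [set x; y], x != y, x \in nodes G & y \in nodes G].
Proof.
move=> /forallP/(_ e)/implyP wfG /wfG/andP[/cards2P[x [y [nxy exy]]]].
rewrite exy => /subsetP sG; exists x, y.
by split=> //; apply: sG; rewrite !inE eqxx ?orbT.
Qed.

Lemma wf_neq G e x y : well_formed ends G -> e \in edges G ->
  ends e = [set x; y] -> x != y.
Proof.
move=> /forallP/(_ e)/implyP wfG /wfG/andP[+ _] exy.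
by rewrite exy cards2; case: (x != y).
Qed.

Lemma wf_nodes G e x : well_formed ends G -> e \in edges G -> x \in ends e ->
  x \in nodes G.
Proof. by move=> /forallP/(_ e)/implyP wfG /wfG/andP[_ /subsetP]; apply. Qed.

Lemma adjP G x y :
  reflect (exists2 e, e \in edges G & ends e = [set x; y]) (adj ends G x y).
Proof.
apply: (iffP exists_inP) => [[e eG /eqP]|[e eG exy]]; exists e => //.
exact/eqP.
Qed.

Lemma adj_sym G : symmetric (adj ends G).
Proof. by move=> x y; apply: eq_existsb => e; rewrite setUC. Qed.

Lemma in_cut_edges G S e x y : well_formed ends G -> e \in edges G ->
  ends e = [set x; y] -> (e \in cut_edges ends G S) = ((x \in S) != (y \in S)).
Proof.
move=> wfG eG exy; have nxy := wf_neq wfG eG exy; rewrite inE eG exy /=.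
have cards1I z : #|[set z] :&: S| = (z \in S).
  have [zS|zS] := boolP (z \in S);
    first by rewrite (setIidPl _) ?sub1set ?cards1.
  by apply/eqP; rewrite cards_eq0 setI_eq0 disjoints1.
have disxy : [disjoint [set x] :&: S & [set y] :&: S].
  by apply: disjointW (subsetIl _ _) (subsetIl _ _) _; rewrite disjoints1 inE.
rewrite setIUl cardsU (disjoint_setI0 disxy) cards0 subn0 !cards1I.
by do 2!case: (_ \in S).
Qed.

Lemma cut_ends G S g : well_formed ends G -> g \in cut_edges ends G S ->
  exists x y, [/\ g \in edges G, ends g = [set x; y], x \in S & y \notin S].
Proof.
move=> wfG gS; have gG : g \in edges G by move: gS; rewrite inE => /andP[].
have [x [y [gxy _ _ _]]] := wf_ends wfG gG.
move: gS; rewrite (in_cut_edges _ wfG gG gxy).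
have [xS|xS] := boolP (x \in S); have [yS|yS] := boolP (y \in S) => // _.
  by exists x, y.
by exists y, x; split=> //; rewrite setUC.
Qed.

Lemma cut_edgesC G S : well_formed ends G ->
  cut_edges ends G (~: S) = cut_edges ends G S.
Proof.
move=> wfG; apply/setP=> e; have [eG|eG] := boolP (e \in edges G); last first.
  by rewrite !inE (negPf eG).
have [x [y [exy _ _ _]]] := wf_ends wfG eG.
by rewrite !(in_cut_edges _ wfG eG exy) !inE; do 2!case: (_ \in S).
Qed.

Definition delete_edge G e : graph T E := Graph (nodes G) (edges G :\ e).

Lemma wf_delete_edge G e : well_formed ends G ->
  well_formed ends (delete_edge G e).
Proof.
move=> /forall_inP wfG; apply/forall_inP=> f /setD1P[_]; exact: wfG.
Qed.

Lemma cut_delete_edge G S e :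
  cut_edges ends (delete_edge G e) S = cut_edges ends G S :\ e.
Proof. by apply/setP=> f; rewrite !inE andbA. Qed.

Lemma walk_edges G x p : walk ends G x p -> {subset unzip1 p <= edges G}.
Proof.
elim: p x => //= -[f y] p IH x /= /and3P[fG _ /IH pG] e.
by rewrite inE => /predU1P[->|/pG].
Qed.

Lemma walk_transfer G H x p : {subset unzip1 p <= edges H} ->
  last x (unzip2 p) \in nodes H -> walk ends G x p -> walk ends H x p.
Proof.
elim: p x => //= -[f y] p IH x pH lH /= /and3P[_ -> wp].
rewrite pH ?mem_head //; apply: IH => // e ep.
by apply: pH; rewrite inE ep orbT.
Qed.

Lemma walk_last G x p : walk ends G x p -> last x (unzip2 p) \in nodes G.
Proof. by elim: p x => //= -[f y] p IH x /= /and3P[_ _]; apply: IH. Qed.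

Lemma walk_ends G x p e z : walk ends G x p -> e \in unzip1 p -> z \in ends e ->
  z \in x :: unzip2 p.
Proof.
elim: p x => //= -[f y] p IH x /= /and3P[_ /eqP fxy wp].
rewrite inE => /predU1P[->|ep].
  by rewrite fxy !inE => /orP[]->; rewrite ?orbT.
by move=> ze; rewrite inE (IH _ wp ep ze) orbT.
Qed.

Lemma walk_nth G x p k e0 : walk ends G x p -> k < size p ->
  ends (nth e0 (unzip1 p) k)
    = [set nth x (x :: unzip2 p) k; nth x (x :: unzip2 p) k.+1].
Proof.
move: {2 4}x => d; elim: p x k => [//|[f y] p IH] x k /= /and3P[_ /eqP fxy wp].
by case: k => [_|k kp] //=; have := IH y k wp kp.
Qed.

Lemma walk_node_edge G x p z : walk ends G x p -> z \in unzip2 p ->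
  exists2 e, e \in unzip1 p & z \in ends e.
Proof.
elim: p x => //= -[f y] p IH x /= /and3P[_ /eqP fxy wp].
rewrite inE => /predU1P[->|/(IH y wp)[e ep ze]].
  by exists f; rewrite ?mem_head // fxy set22.
by exists e; rewrite // inE ep orbT.
Qed.

Lemma walk_cat G x p q : well_formed ends G ->
  walk ends G x (p ++ q) = walk ends G x p && walk ends G (last x (unzip2 p)) q.
Proof.
move=> wfG; elim: p x => [|[f y] p IH] x /=; last by rewrite IH !andbA.
case: q => [|[f y] q] /=; first by rewrite andbb.
case: (boolP (f \in edges G)) => [fG|_]; last by rewrite /= andbF.
case: eqP => [fxy|_]; last by rewrite /= andbF.
by rewrite (wf_nodes wfG fG) // fxy set21.
Qed.

Lemma walk_rev G x p : well_formed ends G -> walk ends G x p ->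
  exists q, [/\ walk ends G (last x (unzip2 p)) q,
    last (last x (unzip2 p)) (unzip2 q) = x, unzip1 q =i unzip1 p
  & {subset unzip2 q <= x :: unzip2 p}].
Proof.
move=> wfG; elim: p x => [|[f y] p IH] x /=; first by exists [::].
case/and3P=> fG /eqP fxy /IH[q [wq lq q1 q2]]; exists (rcons q (f, x)).
rewrite /unzip1 /unzip2 !map_rcons /= last_rcons -cats1 walk_cat // wq lq /= fG.
rewrite fxy setUC eqxx (wf_nodes wfG fG) ?fxy ?set21 //; split=> // [e|z].
  by rewrite mem_rcons !inE -q1.
by rewrite mem_rcons inE => /predU1P[->|/q2]; rewrite !inE ?eqxx // => ->;
  rewrite orbT.
Qed.

Lemma walk_cut G S x p : well_formed ends G -> walk ends G x p ->
  (x \in S) != (last x (unzip2 p) \in S) ->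
  exists2 g, g \in unzip1 p & g \in cut_edges ends G S.
Proof.
move=> wfG; elim: p x => [x _|[f y] p IH x]; first by rewrite eqxx.
move=> /= /and3P[fG /eqP fxy wp] nS.
have [xy|xy] := eqVneq (x \in S) (y \in S).
  rewrite xy in nS; have [g gp gc] := IH _ wp nS.
  by exists g => //; rewrite inE gp orbT.
by exists f; rewrite ?mem_head // (in_cut_edges _ wfG fG fxy).
Qed.

Lemma split_walk x z p : z \in x :: unzip2 p ->
  exists a b, p = a ++ b /\ last x (unzip2 a) = z.
Proof.
elim: p x => [|[f y] p IH] x /=; first
  by rewrite inE => /eqP->; exists [::], [::].
rewrite inE => /predU1P[->|/IH[a [b [-> la]]]];
  first by exists [::], ((f, y) :: p).
by exists ((f, y) :: a), b.
Qed.

Lemma subwalk_between G x p (A B : pred T) : well_formed ends G ->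
  walk ends G x p -> uniq (x :: unzip2 p) -> A x -> B (last x (unzip2 p)) ->
  exists y q, [/\ walk ends G y q, uniq (y :: unzip2 q),
      {subset y :: unzip2 q <= x :: unzip2 p},
      A y /\ {in unzip2 q, forall z, ~~ A z}
    & B (last y (unzip2 q)) /\ {in belast y (unzip2 q), forall z, ~~ B z}].
Proof.
move=> wfG; have [n] := ubnP (size p);
  elim: n x p => // n IHn x p le_n wp up Ax Bl.
have [/hasP[z zp Az]|/hasPn nA] := boolP (has A (unzip2 p)).
  have [|a [b [Ep la]]] := @split_walk x z p; first by rewrite inE zp orbT.
  have suffix : x :: unzip2 p = belast x (unzip2 a) ++ z :: unzip2 b.
    by rewrite Ep /unzip2 map_cat -cat_cons lastI la cat_rcons.
  have lt_b : size b < n.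
    rewrite -ltnS; apply: leq_trans le_n;
      rewrite ltnS Ep size_cat -add1n leq_add2r lt0n.
    by apply: contraTneq zp => /size0nil a0; rewrite -la a0 /=; case/andP: up.
  have [|||y [q [wq uq sub Aq Bq]]] := IHn z b lt_b _ _ Az.
  - by move: wp; rewrite Ep walk_cat // la => /andP[].
  - by move: up; rewrite suffix cat_uniq => /and3P[].
  - by move: Bl; rewrite Ep /unzip2 map_cat last_cat -/unzip2 la.
  by exists y, q; split=> // t /sub tb; rewrite suffix mem_cat tb orbT.
have [/hasP[z zp Bz]|/hasPn nB] := boolP (has B (belast x (unzip2 p)));
  last first.
  by exists x, p; split.
have [|a [b [Ep la]]] := @split_walk x z p; first exact: mem_belast.
have prefix : x :: unzip2 p = (x :: unzip2 a) ++ unzip2 b.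
  by rewrite Ep /unzip2 map_cat.
have lt_a : size a < n.
  rewrite -ltnS; apply: leq_trans le_n;
    rewrite ltnS Ep size_cat -addn1 leq_add2l lt0n.
  apply: contraTneq zp => /size0nil b0; move: up.
  by rewrite lastI rcons_uniq -la Ep b0 cats0 => /andP[].
have [|||y [q [wq uq sub Aq Bq]]] := IHn x a lt_a _ _ Ax.
- by move: wp; rewrite Ep walk_cat // => /andP[].
- by move: up; rewrite prefix cat_uniq => /and3P[].
- by rewrite la.
by exists y, q; split=> // t /sub ta; rewrite prefix mem_cat ta.
Qed.

Lemma uvpath_uniq_edges G u v p : is_uvpath ends G u v p -> uniq (unzip1 p).
Proof.
case/and3P=> wp _ {v};
  elim: p u wp => //= -[f y] p IH u /= /and3P[_ /eqP fuy wp].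
case/andP=> uyp up; rewrite (IH y wp up) andbT; apply: contra uyp => fp.
by apply: (walk_ends wp fp); rewrite fuy set21.
Qed.

Lemma uvpath_delete_edge G u v p e : e \notin unzip1 p ->
  is_uvpath ends G u v p -> is_uvpath ends (delete_edge G e) u v p.
Proof.
move=> ep /and3P[wp lp up]; rewrite /is_uvpath lp up !andbT.
apply: (walk_transfer (H := delete_edge G e) _ (walk_last wp) wp) => f fp.
by rewrite in_setD1 (walk_edges wp fp) andbT; apply: contraNneq ep => <-.
Qed.

Lemma connect_uvpath G x y : well_formed ends G -> x \in nodes G ->
  connect (adj ends G) x y -> exists p, is_uvpath ends G x y p.
Proof.
move=> wfG xG /connectP[p0 /shortenP[p pp up _] ->] {p0 y}.
suff [q wq q2] : exists2 q, walk ends G x q & unzip2 q = p.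
  by exists q; rewrite /is_uvpath wq q2 eqxx.
elim: p x xG pp {up} => [|y p IH] x xG /=; first by exists [::].
case/andP=> /adjP[e eG exy] pp.
have [|q wq q2] := IH y _ pp; first by rewrite (wf_nodes wfG eG) // exy set22.
by exists ((e, y) :: q); rewrite /= ?eG ?exy ?eqxx ?q2.
Qed.

Lemma cycle_rot G x y p : well_formed ends G -> is_cycle ends G x p ->
  y \in unzip2 p ->
  exists2 q, is_cycle ends G y q & {subset unzip1 q <= unzip1 p}.
Proof.
move=> wfG /and5P[p0 wp /eqP lp u1 u2] yp.
have [|a [b [Ep la]]] := @split_walk x y p; first by rewrite inE yp orbT.
exists (b ++ a); last by move=> e; rewrite Ep /unzip1 !map_cat !mem_cat orbC.
move: p0 wp lp u1 u2;
  rewrite Ep walk_cat // la /is_cycle -!size_eq0 !size_cat addnC.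
rewrite /unzip1 /unzip2 !map_cat -/unzip1 -/unzip2 !last_cat la.
move=> -> /andP[wa wb] lb.
by rewrite walk_cat // wb lb wa la eqxx /= uniq_catC => ->; rewrite uniq_catC.
Qed.

End Graphs.

(** * Element connectivity *)

Section ElementConnectivity.

Variables (T E : finType) (ends : E -> {set T}).
Implicit Types (G : graph T E) (Q S : {set T}) (u v x y z : T) (e f g : E).
Implicit Types (b : E + T) (B U : {set E + T}) (p q : seq (E * T)).
Implicit Types (P : {set {bseq #|T| of E * T}}).

Definition hits b g : bool :=
  match b with inl f => g == f | inr z => z \in ends g end.

Definition blocks B g : bool := [exists b in B, hits b g].

Definition elements Q u v : {set E + T} :=
  [set b : E + T | if b is inr z then z \in Q :\: [set u; v] else true].

Definition element_connected Q k G u v : bool :=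
  [forall S : {set T}, forall B : {set E + T},
     [&& (u \in S) != (v \in S), B \subset elements Q u v & #|B| < k] ==>
       [exists g in cut_edges ends G S, ~~ blocks B g]].

Lemma blocks0 g : blocks set0 g = false.
Proof. by apply/exists_inP=> -[b]; rewrite inE. Qed.

Lemma blocks1 b g : blocks [set b] g = hits b g.
Proof.
by apply/exists_inP/idP=> [[_ /set1P->] //|]; exists b; rewrite ?set11.
Qed.

Lemma elementsC Q u v : elements Q u v = elements Q v u.
Proof. by rewrite /elements setUC. Qed.

Lemma element_connectedP Q k G u v :
  reflect (forall S B, (u \in S) != (v \in S) -> B \subset elements Q u v ->
             #|B| < k -> exists2 g, g \in cut_edges ends G S & ~~ blocks B g)
          (element_connected Q k G u v).
Proof.
apply: (iffP forallP) => [conn S B nS BQ ltB|conn S].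
  apply/exists_inP; apply: (implyP (forallP (conn S) B)); exact/and3P.
apply/forallP=> B; apply/implyP=> /and3P[nS BQ ltB].
by apply/exists_inP; apply: conn.
Qed.

Lemma element_connectedPn Q k G u v : ~~ element_connected Q k G u v ->
  exists S B, [/\ (u \in S) != (v \in S), B \subset elements Q u v, #|B| < k
                & {in cut_edges ends G S, forall g, blocks B g}].
Proof.
rewrite negb_forall => /existsP[S]; rewrite negb_forall => /existsP[B].
rewrite negb_imply negb_exists_in
  => /andP[/and3P[nS BQ ltB] /forall_inP blocked].
by exists S, B; split=> // g /blocked; rewrite negbK.
Qed.

Lemma element_connectedC Q k G u v :
  element_connected Q k G u v = element_connected Q k G v u.
Proof.
by apply: eq_forallb => S; apply: eq_forallb => B; rewrite eq_sym elementsC.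
Qed.

Lemma element_connected_refl Q k G u : element_connected Q k G u u.
Proof. by apply/element_connectedP=> S B; rewrite eqxx. Qed.

Lemma element_connected2_unhit Q G u v S b : element_connected Q 2 G u v ->
  (u \in S) != (v \in S) -> b \in elements Q u v ->
  exists2 g, g \in cut_edges ends G S & ~~ hits b g.
Proof.
move=> /element_connectedP conn nS bQ.
have [||g gS] := conn S [set b] nS; rewrite ?sub1set ?cards1 // blocks1.
by exists g.
Qed.

Lemma Qdisjoint_sym Q u v p q : Qdisjoint Q u v p q = Qdisjoint Q u v q p.
Proof.
rewrite /Qdisjoint; congr (~~ _ && ~~ _); first by rewrite has_sym.
by apply/hasP/hasP=> -[x xp /andP[xq xQ]]; exists x => //; rewrite inE xp.
Qed.

Lemma Qdisjoint_edges Q u v p q e :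
  Qdisjoint Q u v p q -> e \in unzip1 p -> e \notin unzip1 q.
Proof. by case/andP=> /hasPn disE _ ep; apply: contraL ep => /disE. Qed.

Lemma Qdisjoint_nodes Q u v p q x : Qdisjoint Q u v p q ->
  x \in Q :\: [set u; v] ->
  x \in unzip2 p -> x \notin unzip2 q.
Proof.
case/andP=> _ /hasPn disQ xQ xp; apply/negP=> /disQ /negP; apply.
exact/andP.
Qed.

Lemma QdisjointP Q u v p q : {in unzip1 p, forall e, e \notin unzip1 q} ->
  {in unzip2 p, forall x, x \in Q :\: [set u; v] -> x \notin unzip2 q} ->
  Qdisjoint Q u v p q.
Proof.
move=> disE disQ; apply/andP; split; apply/hasPn=> c cq.
  by apply: contraL cq => /disE.
by apply/negP=> /andP[cp /(disQ c cp)/negP].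
Qed.

Lemma Qdisjoint_irrefl G u v p Q :
  is_uvpath ends G u v p -> u != v -> ~~ Qdisjoint Q u v p p.
Proof.
case/and3P=> _ lp _ nuv; apply/negP; case: p lp => [|[f y] p] /= lp.
  by rewrite (negPf nuv) in lp.
by move=> /(@Qdisjoint_edges _ _ _ _ _ f); rewrite !mem_head => /(_ isT).
Qed.

Lemma disjoint_walks_connected (I : finType) (w : I -> seq (E * T)) Q G u v :
  well_formed ends G -> (forall i, walk ends G u (w i)) ->
  (forall i, last u (unzip2 (w i)) = v) ->
  (forall i j, i != j -> Qdisjoint Q u v (w i) (w j)) ->
  element_connected Q #|I| G u v.
Proof.
move=> wfG walk_w last_w dis_w; apply: contraT => /element_connectedPn.
case=> S [B [nS /subsetP BQ ltB blocked]].
have /fin_all_exists[b bP] i : exists b, [/\ b \in B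
    & exists2 g, g \in unzip1 (w i) & hits b g].
  have [|g gw /blocked/exists_inP[b bB bg]] := walk_cut (S := S) wfG (walk_w i).
    by rewrite last_w.
  by exists b; split=> //; exists g.
have /injectivePn[i [j nij bij]] : ~~ injectiveb b.
  apply: contraL ltB => /injectiveP b_inj; rewrite -leqNgt.
  rewrite -cardsT -(card_imset setT b_inj) subset_leq_card //.
  by apply/subsetP=> _ /imsetP[i _ ->]; have [] := bP i.
have [biB [g gi big]] := bP i; have [_ [h hj bjh]] := bP j.
have dis := dis_w i j nij; rewrite -bij in bjh.
case: (b i) (BQ _ biB) big bjh => [f _ /eqP gf /eqP hf|z].
  by have := Qdisjoint_edges dis gi; rewrite gf -hf hj.
rewrite inE => zQ zg zh; have zu : z != u by move: zQ; rewrite !inE; case: eqP.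
have := walk_ends (walk_w i) gi zg; have := walk_ends (walk_w j) hj zh.
by rewrite !inE (negPf zu) /= => zj /(Qdisjoint_nodes dis zQ); rewrite zj.
Qed.

Definition path_system Q G u v P : bool :=
  [forall p in P, is_uvpath ends G u v (p : {bseq #|T| of E * T})] &&
  [forall p in P, forall q in P, (p != q) ==> Qdisjoint Q u v p q].

Lemma path_systemP Q G u v P :
  reflect ({in P, forall p : {bseq #|T| of E * T}, is_uvpath ends G u v p} /\
           {in P &, forall p q : {bseq #|T| of E * T},
              p != q -> Qdisjoint Q u v p q})
          (path_system Q G u v P).
Proof.
apply: (iffP andP) => -[/forall_inP paths dis]; split=> //.
- by move=> p q /(forall_inP dis)/forall_inP/[apply]/implyP.
- by apply/forall_inP=> p pP; apply/forall_inP=> q qP; apply/implyP/dis.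
Qed.

Lemma Qlambda_geP Q G u v k :
  reflect (exists2 P, path_system Q G u v P & k <= #|P|)
          (k <= Qlambda ends Q G u v).
Proof.
apply: (iffP idP) => [|[P pathsP leP]]; last first.
  exact: leq_trans leP (leq_bigmax_cond _ pathsP).
have system0 : path_system Q G u v set0.
  by apply/path_systemP; split=> [p|p q]; rewrite inE.
have [|P pathsP maxP] :=
  @eq_bigmax_cond _ (path_system Q G u v) (fun P => #|P|).
  by apply/card_gt0P; exists set0.
by rewrite /Qlambda (maxP : \max_(P | _) _ = _); exists P.
Qed.

Lemma uvpath_size G u v p : is_uvpath ends G u v p -> size p <= #|T|.
Proof.
case/and3P=> _ _ /card_uniqP up; have := max_card [in u :: unzip2 p].
by rewrite up /= size_map; apply: ltnW.
Qed.

End ElementConnectivity.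

Section MixedMenger.

Variables (T E : finType) (ends : E -> {set T}) (G : graph T E).
Variables (Q : {set T}) (u v : T).
Hypothesis wfG : well_formed ends G.
Implicit Types (U D : {set E + T}) (x y : T) (f g : E).

Local Notation Q' := (Q :\: [set u; v]).

(* Edges and nodes of Q \ {u, v} become vertices, so that vertex-disjoint paths
   of this relation are the disjoint paths counted by Qlambda; the remaining
   nodes may be shared and only make their incident edges adjacent. *)
Definition element_rel : rel (E + T) := fun a b =>
  match a, b with
  | inl f, inl g => [&& f \in edges G, g \in edges G &
                     [exists y, [&& y \in ends f, y \in ends g & y \notin Q']]]
  | inl f, inr q => [&& f \in edges G, q \in Q' & q \in ends f]
  | inr q, inl f => [&& f \in edges G, q \in Q' & q \in ends f]
  | inr _, inr _ => false
  end.

Definition edges_at x : {set E + T} :=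
  [set a : E + T |
    if a is inl f then (f \in edges G) && (x \in ends f) else false].

Lemma element_connected_linked k D : u != v ->
  element_connected ends Q k G u v ->
  #|D| < k -> linked element_rel (~: D) (edges_at u) (edges_at v).
Proof.
move=> nuv /element_connectedP conn ltD; apply: contraT => nlinked.
pose Z := [set a | linked element_rel (~: D) (edges_at u) [set a]].
have Z_step a b : a \in Z -> element_rel a b -> b \notin D -> b \in Z.
  by rewrite !inE => ua ab bD; apply: linked_rcons ua ab _; rewrite inE.
pose reached x f :=
  [&& f \in edges G, x \in ends f, inl f \in Z & (x \in Q') ==> (inr x \in Z)].
pose S := [set x | (x == u) || [exists f, reached x f]].
have uS : u \in S by rewrite inE eqxx.
have vS : v \notin S.
  rewrite inE negb_or eq_sym nuv; apply/existsP=> -[f /and4P[fG vf + _]].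
  rewrite inE => uf; case/negP: nlinked; case/linked_target: (uf) => a.
  rewrite !inE => /andP[/eqP-> fD] _; rewrite -[~: D]setUid.
  apply: (linked_cat uf (y := inl f)); rewrite ?eqxx //.
  by apply: (@linked_refl _ _ _ _ _ (inl f)); rewrite !inE ?fG.
have [||| g gS] := conn S (D :&: elements E Q u v);
  rewrite ?uS ?vS ?subsetIr //.
  exact: leq_ltn_trans (subset_leq_card (subsetIl _ _)) ltD.
have [x [y [gG gxy xS yS]]] := cut_ends wfG gS.
have [xg yg] : x \in ends g /\ y \in ends g by rewrite gxy set21 set22.
case/negP; apply/exists_inP; have [gD|gD] := boolP (inl g \in D).
  by exists (inl g); rewrite /= ?eqxx // !inE gD.
have gZ : inl g \in Z.
  move: xS; rewrite inE => /predU1P[xu|/existsP[f /and4P[fG xf fZ /implyP xZ]]].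
    by rewrite inE; apply: (@linked_refl _ _ _ _ _ (inl g));
      rewrite !inE ?gG -?xu.
  have [xQ|xQ] := boolP (x \in Q');
    first by apply: Z_step (xZ xQ) _ gD; apply/and3P.
  apply: Z_step fZ _ gD; rewrite /= fG gG; apply/existsP; exists x.
  by rewrite xf xg.
have /andP[yQ yZ] : (y \in Q') && (inr y \notin Z).
  rewrite -negb_imply; apply: contra yS => yZ; rewrite inE; apply/orP; right.
  by apply/existsP; exists g; apply/and4P.
exists (inr y) => //; rewrite in_setI [_ \in elements _ _ _ _]inE yQ andbT.
by apply: contraR yZ; apply: Z_step gZ _; apply/and3P.
Qed.

Definition usable U y := (y \in Q') ==> (inr y \in U).

Definition element_subgraph U : graph T E :=
  Graph (nodes G)
    [set f in edges G | (inl f \in U) && [forall y in ends f, usable U y]].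

Lemma element_subgraph_connect U g x y : g \in edges G -> inl g \in U ->
  x \in ends g -> y \in ends g -> usable U x -> usable U y ->
  connect (adj ends (element_subgraph U)) x y.
Proof.
move=> gG gU xg yg xU yU; have [->|nxy] := eqVneq x y; first exact: connect0.
have gxy : ends g = [set x; y].
  have [a [b [gab nab _ _]]] := wf_ends wfG gG; apply/eqP.
  by rewrite eq_sym eqEcard subUset !sub1set xg yg gab !cards2 nab nxy.
apply/connect1/adjP; exists g => //; rewrite inE gG gU.
by apply/forall_inP=> z; rewrite gxy => /set2P[]->.
Qed.

Lemma linked_connect U : linked element_rel U (edges_at u) (edges_at v) ->
  connect (adj ends (element_subgraph U)) u v.
Proof.
have usable_end z : z \in [set u; v] -> usable U z
  by move=> zuv; rewrite /usable in_setD zuv.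
case/linkedP=> a [p [+ + + pe]]; rewrite inE;
  case: a pe => // f pe /andP[fG uf] lp pU.
suff reach a : path element_rel a p -> last a p \in edges_at v ->
  all [in U] (a :: p) ->
    match a with
    | inl f => f \in edges G -> exists y,
        [/\ y \in ends f, usable U y
          & connect (adj ends (element_subgraph U)) y v]
    | inr q => connect (adj ends (element_subgraph U)) q v
    end.
  have [y [yf yU yv]] := reach _ pe lp pU fG; apply: connect_trans yv.
  apply: (element_subgraph_connect fG) => //; first by case/andP: pU.
  by apply: usable_end; rewrite set21.
elim: p a {f pe fG uf lp pU} => [|b p IH] a /=.
  rewrite inE; case: a => // f _ /andP[fG vf] _ _; exists v.
  by rewrite usable_end ?set22.
case: a => [f|q]; case: b => [g|q'] //= /andP[+ pe] lp /and3P[aU bU pU].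
- case/and3P=> fG gG /existsP[y /and3P[yf yg yQ]] _.
  have yU : usable U y by rewrite /usable (negPf yQ).
  have [|z [zg zU zv]] := IH _ pe lp _ gG; first exact/andP.
  exists y; split=> //; apply: connect_trans zv.
  exact: (element_subgraph_connect gG).
- case/and3P=> fG qQ qf _; exists q'; rewrite /usable bU implybT; split=> //.
  by apply: (IH (inr q')) => //; apply/andP.
- case/and3P=> gG qQ qg; have [|z [zg zU zv]] := IH _ pe lp _ gG;
    first exact/andP.
  by apply: connect_trans zv; apply: (element_subgraph_connect gG);
    rewrite /usable ?aU ?implybT.
Qed.

Lemma linked_uvpath U : u \in nodes G ->
  linked element_rel U (edges_at u) (edges_at v) ->
  exists p, [/\ is_uvpath ends G u v p, {in unzip1 p, forall f, inl f \in U}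
              & {in unzip2 p, forall y, usable U y}].
Proof.
move=> uG /linked_connect; set H := element_subgraph U.
have wfH : well_formed ends H.
  by apply/forall_inP=> f; rewrite inE => /andP[fG _]; apply: (forall_inP wfG).
case/(connect_uvpath wfH uG)=> p pP; exists p; case/and3P: pP => wp lp up.
have HG : {subset unzip1 p <= edges G}.
  by move=> f /(walk_edges wp); rewrite inE => /andP[].
have pU f : f \in unzip1 p -> inl f \in U /\ {in ends f, forall y, usable U y}.
  by move/(walk_edges wp); rewrite inE => /and3P[_ fU /forall_inP].
split=> [|f /pU[]//|y yp].
  by rewrite /is_uvpath lp up (walk_transfer HG (walk_last wp) wp).
have [f fp yf] := walk_node_edge wp yp.
by have [_] := pU f fp; apply.
Qed.

Theorem leq_Qlambda_connected k : u \in nodes G -> u != v ->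
  (k <= Qlambda ends Q G u v) = element_connected ends Q k G u v.
Proof.
move=> uG nuv;
  apply/idP/idP => [/Qlambda_geP[P /path_systemP[pathsP disP] leP]|conn].
  suff: element_connected ends Q #|{: {p | p \in P}}| G u v.
    rewrite card_sig => /element_connectedP conn;
      apply/element_connectedP=> S B nS BQ ltB.
    by apply: conn => //; apply: leq_trans ltB leP.
  apply: (disjoint_walks_connected (w := fun p : {p | p \in P} => val p)) => //.
  - by case=> p /= /pathsP/and3P[].
  - by case=> p /= /pathsP/and3P[_ /eqP].
  - by move=> [p pP] [q qP] npq; apply: disP.
have [F [tF leF linkF]] := menger (fun D => element_connected_linked nuv conn).
have /fin_all_exists[p pP] (U : {set E + T}) :
    exists p : {bseq #|T| of E * T}, U \in F ->
    [/\ is_uvpath ends G u v p, {in unzip1 p, forall f, inl f \in U}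
      & {in unzip2 p, forall y, usable U y}].
  have [UF|] := boolP (U \in F); last by exists [bseq].
  have [p pP] := linked_uvpath uG (linkF U UF).
  have [/uvpath_size szp _ _] := pP.
  by exists (Bseq szp).
have disF U V : U \in F -> V \in F -> U != V -> Qdisjoint Q u v (p U) (p V).
  move=> UF VF nUV; have disUV := trivIsetP tF U V UF VF nUV.
  have [_ EU QU] := pP U UF; have [_ EV QV] := pP V VF.
  apply: QdisjointP => [f /EU fU|y /QU/implyP yU yQ].
    by apply/negP=> /EV fV; rewrite (disjointFr disUV fU) in fV.
  by apply/negP=> /QV/implyP/(_ yQ) yV;
    rewrite (disjointFr disUV (yU yQ)) in yV.
have p_inj : {in F &, injective p}.
  move=> U V UF VF pUV; apply/eqP; apply: contraT => /(disF U V UF VF).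
  have [/Qdisjoint_irrefl irrefl _ _] := pP U UF.
  by rewrite -pUV (negPf (irrefl Q nuv)).
apply/Qlambda_geP; exists (p @: F); last by rewrite card_in_imset.
apply/path_systemP; split=> [_ /imsetP[U UF ->]|]; first by case: (pP U UF).
move=> _ _ /imsetP[U UF ->] /imsetP[V VF ->] npUV; apply: disF => //.
by apply: contra_neq npUV => ->.
Qed.

End MixedMenger.

Section DisjointPaths.

Variables (T E : finType) (ends : E -> {set T}) (G : graph T E) (Q : {set T}).
Hypothesis wfG : well_formed ends G.
Implicit Types (u v x y z : T) (a b p q : seq (E * T)).

Lemma two_walks_connected u v p q : walk ends G u p -> walk ends G u q ->
  last u (unzip2 p) = v -> last u (unzip2 q) = v -> Qdisjoint Q u v p q ->
  element_connected ends Q 2 G u v.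
Proof.
move=> wp wq lp lq dis; rewrite -card_bool.
apply: (disjoint_walks_connected (w := fun i : bool => if i then p else q))
  => //.
- by case.
- by case.
- by case=> [] [] //; rewrite Qdisjoint_sym.
Qed.

Lemma uvpath_cat_nodes u v a b z : is_uvpath ends G u v (a ++ b) ->
  z \in u :: unzip2 a -> z \notin unzip2 b.
Proof.
case/and3P=> _ _; rewrite /unzip2 map_cat -/unzip2 -cat_cons cat_uniq.
by case/and3P=> _ /hasPn dis _ za; apply: contraL za => /dis.
Qed.

Lemma uvpath_cat_edges u v a b e : is_uvpath ends G u v (a ++ b) ->
  e \in unzip1 a -> e \notin unzip1 b.
Proof.
move/uvpath_uniq_edges; rewrite /unzip1 map_cat -/unzip1 cat_uniq.
by case/and3P=> _ /hasPn dis _ ea; apply: contraL ea => /dis.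
Qed.

Lemma Qdisjoint_cat_edges u v a b c d e : Qdisjoint Q u v (a ++ b) (c ++ d) ->
  e \in unzip1 a -> e \notin unzip1 d.
Proof.
move=> dis ea; have := Qdisjoint_edges dis (e := e).
rewrite /unzip1 !map_cat -/unzip1 !mem_cat ea => /(_ isT).
by rewrite negb_or => /andP[].
Qed.

Lemma Qdisjoint_cat_nodes u v a b c d z :
  is_uvpath ends G u v (a ++ b) -> is_uvpath ends G u v (c ++ d) ->
  Qdisjoint Q u v (a ++ b) (c ++ d) -> last u (unzip2 a) != v ->
  z \in Q -> z \in u :: unzip2 a -> z \notin unzip2 d.
Proof.
move=> abP cdP dis nav zQ; rewrite inE => /predU1P[->|za].
  exact: uvpath_cat_nodes cdP (mem_head _ _).
have zab : z \in unzip2 (a ++ b) by rewrite /unzip2 map_cat mem_cat za.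
have zu : z != u.
  by apply: contraTneq zab => ->; case/and3P: abP => _ _ /andP[].
have zv : z != v.
  have vb : v \in unzip2 b.
    case/and3P: abP nav => _ /eqP <- _;
      rewrite /unzip2 map_cat last_cat -/unzip2.
    by case: (unzip2 b) => [|y s]; rewrite ?eqxx //= mem_last.
  apply: contraTneq vb => <-; apply: uvpath_cat_nodes abP _.
  by rewrite inE za orbT.
have := Qdisjoint_nodes dis _ zab; rewrite /unzip2 map_cat mem_cat negb_or.
by rewrite !inE negb_or zu zv zQ => /(_ isT)/andP[].
Qed.

Lemma walk_edge_off_uvpath u v p x q z0 e : is_uvpath ends G u v p ->
  walk ends G x q -> u \notin x :: unzip2 q ->
  {in x :: unzip2 q, forall z, z \in unzip2 p -> z = z0} ->
  e \in unzip1 q -> e \notin unzip1 p.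
Proof.
move=> /and3P[wp _ _] wq uq only_z0 eq; apply/negP=> ep.
have [a [b [eab nab _ _]]] := wf_ends wfG (walk_edges wq eq).
have end_z0 z : z \in ends e -> z = z0.
  move=> ze; have zq := walk_ends wq eq ze; apply: only_z0 => //.
  have := walk_ends wp ep ze; rewrite inE => /predU1P[zu|//].
  by rewrite -zu zq in uq.
have [az bz] : a = z0 /\ b = z0
  by split; apply: end_z0; rewrite eab ?set21 ?set22.
by rewrite az bz eqxx in nab.
Qed.

(* One walk from x to y runs through u and the other through v. *)
Lemma disjoint_paths_connected u v p q x y :
  is_uvpath ends G u v p -> is_uvpath ends G u v q -> Qdisjoint Q u v p q ->
  x \in unzip2 p -> y \in unzip2 q -> x != v -> y != v ->
  element_connected ends Q 2 G x y.
Proof.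
move=> pP qP dis xp yq nxv nyv.
have [|a [b [Ep la]]] := @split_walk _ _ u x p; first by rewrite inE xp orbT.
have [|c [d [Eq lc]]] := @split_walk _ _ u y q; first by rewrite inE yq orbT.
rewrite Ep Eq in pP qP dis.
have [/and3P[wab /eqP lab _] /and3P[wcd /eqP lcd _]] := (pP, qP).
move: wab wcd lab lcd;
  rewrite !walk_cat // /unzip2 !map_cat -/unzip2 !last_cat la lc.
move=> /andP[wa wb] /andP[wc wd] lb ld.
have [a' [+ + a'E a'N]] := walk_rev wfG wa; rewrite la => wa' la'.
have [d' [+ + d'E d'N]] := walk_rev wfG wd; rewrite ld => wd' ld'.
have dis_sym : Qdisjoint Q u v (c ++ d) (a ++ b) by rewrite Qdisjoint_sym.
apply: (@two_walks_connected _ _ (a' ++ c) (b ++ d')).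
- by rewrite walk_cat // wa' la'.
- by rewrite walk_cat // wb lb.
- by rewrite /unzip2 map_cat last_cat -/unzip2 la'.
- by rewrite /unzip2 map_cat last_cat -/unzip2 lb.
apply: QdisjointP => [e|z].
  rewrite /unzip1 !map_cat -/unzip1 !mem_cat a'E d'E negb_or.
  case/orP=> [ea|ec].
    by rewrite (uvpath_cat_edges pP ea) (Qdisjoint_cat_edges dis ea).
  by rewrite (uvpath_cat_edges qP ec) (Qdisjoint_cat_edges dis_sym ec).
have b_off t : t \in Q -> t \in u :: unzip2 a \/ t \in u :: unzip2 c ->
  t \notin unzip2 b.
  move=> tQ [/(uvpath_cat_nodes pP)//|];
    apply: Qdisjoint_cat_nodes qP pP dis_sym _ tQ.
  by rewrite lc.
have d_off t : t \in Q -> t \in u :: unzip2 a \/ t \in u :: unzip2 c ->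
  t \notin unzip2 d.
  move=> tQ [|/(uvpath_cat_nodes qP)//];
    apply: Qdisjoint_cat_nodes pP qP dis _ tQ.
  by rewrite la.
rewrite /unzip2 !map_cat -/unzip2 !mem_cat !inE !negb_or
  => zac /andP[/andP[zx zy] zQ].
have {}zac : z \in u :: unzip2 a \/ z \in u :: unzip2 c.
  case/orP: zac => [/a'N|zc]; last by right; rewrite inE zc orbT.
  by left.
rewrite b_off //=; apply: contra (d_off z zQ zac) => /d'N.
by rewrite inE (negPf zy).
Qed.

End DisjointPaths.

(** * Uncrossing *)

Section Uncrossing.

Variables (T E : finType) (ends : E -> {set T}) (G : graph T E).
Hypothesis wfG : well_formed ends G.
Variables (A S : {set T}) (e f : E) (t y z : T).
Hypotheses (te : t \in ends e) (tf : t \in ends f) (tA : t \in A)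
  (tS : t \notin S).
Hypotheses (zA : z \notin A) (zS : z \in S) (yA : y \notin A) (yS : y \notin S).
Hypothesis cutA : {in cut_edges ends G A, forall g, g = e \/ z \in ends g}.
Hypothesis cutS : {in cut_edges ends G S, forall g, g = f \/ y \in ends g}.

Lemma uncross_setI :
  {in cut_edges ends G (A :&: S), forall g, g = f \/ z \in ends g}.
Proof.
move=> g /(cut_ends wfG)[a [b [gG gab /setIP[aA aS]]]]; rewrite in_setI => bAS.
have [bA|bA] := boolP (b \in A).
  rewrite bA /= in bAS; have [||] := cutS (x := g); [|by left|].
    by rewrite (in_cut_edges _ wfG gG gab) aS (negPf bAS).
  by rewrite gab => /set2P[] Ey; case/negP: yA; rewrite Ey.
have [|Eg|] := cutA (x := g); [| |by right].
  by rewrite (in_cut_edges _ wfG gG gab) aA (negPf bA).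
have := te; rewrite -Eg gab => /set2P[] Et; first by case/negP: tS; rewrite Et.
by rewrite -Et tA in bA.
Qed.

Lemma uncross_setD : {in cut_edges ends G (A :\: S), forall g, t \in ends g}.
Proof.
move=> g /(cut_ends wfG)[a [b [gG gab /setDP[aA aS]]]].
rewrite in_setD negb_and negbK => bAS.
have touch_of_bS : b \in S -> y != b -> t \in ends g.
  move=> bS nyb; have [||] := cutS (x := g); [|by move->|].
    by rewrite (in_cut_edges _ wfG gG gab) (negPf aS) bS.
  rewrite gab => /set2P[] Ey; last by rewrite Ey eqxx in nyb.
  by case/negP: yA; rewrite Ey.
have [bA|bA] := boolP (b \in A).
  rewrite bA orbF in bAS; apply: touch_of_bS => //.
  by apply: contraNneq yA => ->.
have [||] := cutA (x := g); [|by move->|].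
  by rewrite (in_cut_edges _ wfG gG gab) aA (negPf bA).
rewrite {1}gab => /set2P[] Ez; first by case/negP: zA; rewrite Ez.
by apply: touch_of_bS; [rewrite -Ez | apply: contraNneq yS => ->; rewrite -Ez].
Qed.

End Uncrossing.

(** * R-components *)

Section Components.

Variables (T E : finType) (ends : E -> {set T}) (G : graph T E) (R C : {set T}).
Hypothesis wfG : well_formed ends G.
Hypothesis compC : C \in components ends (graphD ends G R).
Implicit Types (x y c d : T) (e : E).

Local Notation GR := (graphD ends G R).
Local Notation K := (Rcomponent ends G C).

Lemma component_sub : C \subset nodes G :\: R.
Proof.
by case/imsetP: compC => x _ ->; apply/subsetP=> y; rewrite inE => /andP[].
Qed.

Lemma component_notR c : c \in C -> c \notin R.
Proof. by move/(subsetP component_sub)/setDP=> []. Qed.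

Lemma component_neq0 : exists c, c \in C.
Proof.
by case/imsetP: compC => x xG ->; exists x; rewrite inE xG connect0.
Qed.

Lemma component_step c y : c \in C -> adj ends G c y -> y \notin R -> y \in C.
Proof.
case/imsetP: compC => x _ ->; rewrite !inE => /andP[/andP[cR cG] xc].
move=> /adjP[e eG ecy] yR; rewrite yR (wf_nodes wfG eG) ?ecy ?set22 //=.
apply: connect_trans xc _; apply/connect1/adjP; exists e => //.
rewrite inE eG disjoint_subset; apply/subsetP=> z; rewrite ecy !inE.
by case/orP=> /eqP->.
Qed.

Lemma neighbors_R y : y \in neighbors ends G C -> y \in R.
Proof.
rewrite inE => /andP[/setDP[_ yC] /exists_inP[c cC cy]].
by apply: contraR yC => /(component_step cC cy).
Qed.

Lemma adj_neighbors c y : c \in C -> adj ends G c y -> y \notin C ->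
  y \in neighbors ends G C.
Proof.
move=> cC cy yC; rewrite inE in_setD yC /=; apply/andP; split; last first.
  by apply/exists_inP; exists c.
by have [e eG ecy] := adjP _ _ _ _ cy; rewrite (wf_nodes wfG eG) // ecy set22.
Qed.

Lemma Rcomponent_edges_sub : edges K \subset edges G.
Proof. by apply/subsetP=> e /setUP[] /[!inE] /andP[]. Qed.

Lemma in_Rcomponent_edges e x y : e \in edges G -> ends e = [set x; y] ->
  (e \in edges K) = (x \in C) || (y \in C).
Proof.
move=> eG exy;
  rewrite in_setU (in_cut_edges C wfG eG exy) inE eG exy subUset !sub1set.
by case: (x \in C); case: (y \in C).
Qed.

Lemma wf_graphD : well_formed ends GR.
Proof.
apply/forall_inP=> e; rewrite inE => /andP[eG dis].
have /andP[-> eV] := forall_inP wfG e eG.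
by rewrite subsetD eV dis.
Qed.

Lemma component_walk c p : c \in C -> walk ends GR c p ->
  {subset c :: unzip2 p <= C}.
Proof.
elim: p c => [|[e y] p IH] c cC /=; first by move=> _ z /[!inE] /eqP->.
case/and3P=> /[!inE] /andP[eG dis] /eqP ecy wp z;
  rewrite inE => /predU1P[->//|].
apply: IH => //; apply: (component_step cC); first by apply/adjP; exists e.
by rewrite (disjointFr dis) // ecy set22.
Qed.

Lemma component_uvpath c d : c \in C -> d \in C ->
  exists2 p, is_uvpath ends K c d p & {subset c :: unzip2 p <= C}.
Proof.
move=> cC dC; have cGR : c \in nodes GR by apply: (subsetP component_sub).
have /(connect_uvpath wf_graphD cGR)[p pP] : connect (adj ends GR) c d.
  move: cC dC; case/imsetP: compC => x _ ->;
    rewrite !inE => /andP[_ xc] /andP[_ xd].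
  by apply: connect_trans xd; rewrite sym_connect_sym //; apply: adj_sym.
case/and3P: (pP) => wp /eqP lp up; have pC := component_walk cC wp.
exists p => //; rewrite /is_uvpath lp eqxx up !andbT.
apply: (walk_transfer _ _ wp) => [e ep|]; last by rewrite lp inE dC.
have eG : e \in edges G by have := walk_edges wp ep; rewrite inE => /andP[].
have [x [y [exy _ _ _]]] := wf_ends wfG eG;
  rewrite (in_Rcomponent_edges eG exy).
by rewrite pC // (walk_ends wp ep) // exy set21.
Qed.

Lemma Rcomponent_uvpath x c : x \in nodes K -> c \in C ->
  exists2 p, is_uvpath ends K x c p & {subset unzip2 p <= C}.
Proof.
move=> xK cC; have [xC|xC] := boolP (x \in C).
  have [p pP pC] := component_uvpath xC cC.
  by exists p => // z zp; apply: pC; rewrite inE zp orbT.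
have /exists_inP[d dC dx] : [exists d in C, adj ends G d x].
  by move: xK; rewrite !inE (negPf xC) => /andP[].
have [e eG edx] := adjP _ _ _ _ dx;
  have [p /and3P[wp lp up] pC] := component_uvpath dC cC.
exists ((e, d) :: p); last exact: pC.
rewrite /is_uvpath /= wp lp (in_Rcomponent_edges eG edx) dC edx setUC eqxx.
by rewrite /=; apply/andP; split=> //; apply: contra xC; apply: pC.
Qed.

Lemma Rcomponent_connected : connected ends K.
Proof.
have [c cC] := component_neq0.
have to_c x : x \in nodes K -> connect (adj ends K) x c.
  move=> xK; have [p /and3P[wp /eqP <- _] _] := Rcomponent_uvpath xK cC.
  elim: p x wp {xK} => [|[e y] p IH] x //= /and3P[eK exy /IH];
    apply: connect_trans.
  by apply/connect1/existsP; exists e; rewrite eK.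
split; first by apply/set0Pn; exists c; rewrite in_setU cC.
move=> x y /to_c xc /to_c; rewrite sym_connect_sym; last exact: adj_sym.
exact: connect_trans.
Qed.

End Components.

(** * Minimally connected graphs *)

Section Minimal.

Variables (T E : finType) (ends : E -> {set T}) (G : graph T E).
Variables (R Q : {set T}) (r : T -> T -> nat).
Hypotheses (wfG : well_formed ends G) (RV : R \subset nodes G).
Hypothesis minG : minimally_rQ_connected ends r R Q G.

Lemma minimal_element_connected u v : u \in R -> v \in R ->
  element_connected ends Q (r u v) G u v.
Proof.
move=> uR vR; have [->|nuv] := eqVneq u v; first exact: element_connected_refl.
rewrite -leq_Qlambda_connected // ?(subsetP RV) //.
by have [->//|r_gt0] := posnP (r u v); apply: minG.1.
Qed.

Lemma minimal_edge_tight_cut e : e \in edges G ->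
  exists u v (S : {set T}) (B : {set E + T}),
  [/\ u \in R, v \in R, (u \in S) != (v \in S), e \in cut_edges ends G S
    & [/\ B \subset elements E Q u v, #|B| < r u v
        & {in cut_edges ends G S, forall g, g = e \/ blocks ends B g}]].
Proof.
move=> eG; pose H := delete_edge G e.
have wfH : well_formed ends H by apply: wf_delete_edge.
have propH : proper_subgraph ends H G.
  split=> //; first exact: subsetDl.
  by move=> HG; have : e \in edges H by [rewrite HG]; rewrite !inE eqxx.
have [|not_conn] :=
  boolP [forall u in R, forall v in R, (u != v) && (0 < r u v) ==>
    (r u v <= Qlambda ends Q H u v)].
  move=> conn; case: (minG.2 H propH) => u v uR vR nuv r_gt0.
  by have := forall_inP (forall_inP conn u uR) v vR; rewrite nuv r_gt0.
move: not_conn; rewrite negb_forall_in => /exists_inP[u uR].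
rewrite negb_forall_in => /exists_inP[v vR].
rewrite negb_imply -andbA => /and3P[nuv _];
  rewrite leq_Qlambda_connected ?(subsetP RV) //.
case/element_connectedPn=> S [B [nS BQ ltB blocked]]; exists u, v, S, B.
have cutS : {in cut_edges ends G S, forall g, g = e \/ blocks ends B g}.
  move=> g gS; have [->|nge] := eqVneq g e; [by left | right].
  by apply: blocked; rewrite cut_delete_edge in_setD1 nge.
have /element_connectedP connG := minimal_element_connected uR vR.
have [g gS nB] := connG S B nS BQ ltB.
split=> //; by case: (cutS g gS) => [<-//|]; rewrite (negPf nB).
Qed.

Hypothesis r_le2 : {in R &, forall u v, r u v <= 2}.

Definition R_biconnected u v : bool :=
  [&& u \in R, v \in R & element_connected ends Q 2 G u v].

Lemma R_biconnectedC u v : R_biconnected u v = R_biconnected v u.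
Proof. by rewrite /R_biconnected element_connectedC andbCA. Qed.

Lemma R_biconnected_unseparated u v z (A : {set T}) :
  R_biconnected u v -> u \in A -> v \notin A -> z \in Q :\: [set u; v] ->
  ~ {in cut_edges ends G A, forall g, z \in ends g}.
Proof.
case/and3P=> _ _ conn uA vA zQ all_z.
have [||g /all_z zg] := element_connected2_unhit (S := A) (b := inr z) conn.
- by rewrite uA (negPf vA).
- by rewrite inE.
- by rewrite /= zg.
Qed.

(* The biset (A, z |: A) separates u from v, and no edge but e may cover it. *)
Definition tight e z (A : {set T}) u v : Prop :=
  [/\ R_biconnected u v, u \in A, v \notin A,
    z \in Q :\: [set u; v] & z \notin A] /\
  {in cut_edges ends G A, forall g, g = e \/ z \in ends g}.

Lemma tight_setD1 e z (S : {set T}) u v :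
  R_biconnected u v -> u \in S -> v \notin S -> z \in Q :\: [set u; v] ->
  {in cut_edges ends G S, forall g, g = e \/ z \in ends g} ->
  tight e z (S :\ z) u v.
Proof.
move=> conn uS vS zQ cutS; split.
  split; rewrite ?in_setD1 ?eqxx ?negb_and ?vS ?orbT ?uS ?andbT //.
  by move: zQ; rewrite !inE negb_or eq_sym -andbA => /andP[].
move=> g /(cut_ends wfG)[x [y [gG gxy /setD1P[nxz xS]]]].
rewrite in_setD1 negb_and negbK => /orP[/eqP<-|yS];
  first by right; rewrite gxy set22.
by apply: cutS; rewrite (in_cut_edges _ wfG gG gxy) xS (negPf yS).
Qed.

Lemma tight_touch e z A u v : tight e z A u v -> z \notin ends e.
Proof.
case=> -[conn uA vA zQ _] cutA; apply/negP=> ze.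
by apply: (R_biconnected_unseparated conn uA vA zQ) => g /cutA[->|].
Qed.

(* The trail w 0, ..., w n may be closed. *)
Section Trail.

Variables (w : nat -> T) (ed : nat -> E) (n : nat).
Hypothesis ed_edges : forall i, i < n -> ed i \in edges G.
Hypothesis ed_ends : forall i, i < n -> ends (ed i) = [set w i; w i.+1].
Hypothesis ed_inj : forall i j, i < n -> j < n -> ed i = ed j -> i = j.
Hypothesis w_neq : forall i j, i < j <= n -> (0 < i) || (j < n) -> w i != w j.
Hypothesis w_inner : forall i, 0 < i < n -> w i \in Q :\: R.
Hypothesis ends_connected : forall i, i < n ->
  element_connected ends Q 2 (delete_edge G (ed i)) (w 0) (w n).

(* On a closed trail the node w 0 is only indexed by n. *)
Definition trail_index j := (j <= n) && ((0 < j) || (w 0 != w n)).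

Lemma trail_index_le i j : trail_index i -> i <= j <= n -> trail_index j.
Proof.
case/andP=> _ /orP[i_gt0|w0n] /andP[ij jn];
  rewrite /trail_index jn ?w0n ?orbT //.
by rewrite (leq_trans i_gt0 ij).
Qed.

Lemma trail_index_lt_neq i j : trail_index i -> i < j <= n -> w i != w j.
Proof.
case/andP=> _ i_ok /andP[ij jn]; have [i_gt0|i0] := ltnP 0 i.
  by apply: w_neq; rewrite ?ij // i_gt0.
have {i0} i_0 : i = 0 by apply/eqP; rewrite -leqn0.
move: i_ok; rewrite i_0 /= in ij * => w0n; have [->//|jn'] := eqVneq j n.
by apply: w_neq; rewrite ?ij //= ltn_neqAle jn' jn.
Qed.

Lemma trail_index_inj i j : trail_index i -> trail_index j -> w i = w j ->
  i = j.
Proof.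
move=> iP jP wij; case: (ltngtP i j) => // [ij|ji].
  have := trail_index_lt_neq iP (j := j); rewrite ij wij eqxx.
  by case/andP: jP => -> _ /(_ isT).
have := trail_index_lt_neq jP (j := i); rewrite ji wij eqxx.
by case/andP: iP => -> _ /(_ isT).
Qed.

Lemma trail_index_touch j k : trail_index j -> trail_index k -> k < n ->
  w j \in ends (ed k) -> j = k \/ j = k.+1.
Proof.
move=> jP kP kn; rewrite ed_ends // => /set2P[];
  first by left; apply: trail_index_inj.
by right; apply: trail_index_inj => //; apply: trail_index_le kP _;
  rewrite leqnSn.
Qed.

Lemma trail_side_const (S : {set T}) a b : a <= b -> b <= n ->
  (forall k, a <= k < b -> ed k \notin cut_edges ends G S) ->
  (w a \in S) = (w b \in S).
Proof.
elim: b => [|b IH]; first by rewrite leqn0 => /eqP->.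
rewrite leq_eqVlt => /predU1P[-> //|ab] bN nocut.
rewrite IH // ?(ltnW bN) // => [|k /andP[ak kb]]; last first.
  by apply: nocut; rewrite ak ltnW.
have := nocut b; rewrite ltnSn andbT => /(_ ab).
by rewrite (in_cut_edges _ wfG (ed_edges bN) (ed_ends bN)) negbK => /eqP.
Qed.

Lemma trail_edge_breaker i (S : {set T}) b : i < n -> w i \notin S ->
  w i.+1 \in S ->
  b \in elements E Q (w 0) (w n) ->
  {in cut_edges ends G S, forall g, g = ed i \/ hits ends b g} ->
  exists k, [/\ k < n, k != i & hits ends b (ed k)].
Proof.
move=> iN wiS wiS' bQ cutS.
have [/existsP[k /andP[ki bk]]|none] :=
  boolP [exists k : 'I_n, (val k != i) && hits ends b (ed k)].
  by exists (val k); rewrite ltn_ord.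
have nocut k : k < n -> k != i -> ed k \notin cut_edges ends G S.
  move=> kN ki; apply: contra none => /cutS[/(ed_inj kN iN)/eqP|bk].
    by rewrite (negPf ki).
  by apply/existsP; exists (Ordinal kN); rewrite ki.
have w0S : w 0 \notin S.
  rewrite (@trail_side_const S 0 i) ?(ltnW iN) // => k /= ki.
  by apply: nocut; rewrite ?(ltn_trans ki) // ltn_eqF.
have wnS : w n \in S.
  rewrite -(@trail_side_const S i.+1 n) // => k /andP[ik kn].
  by apply: nocut; rewrite // gtn_eqF.
have [|g] :=
  element_connected2_unhit (S := S) (b := b) (ends_connected iN) _ bQ.
  by rewrite (negPf w0S) wnS.
by rewrite cut_delete_edge => /setD1P[/eqP ngi /cutS[//|->]].
Qed.

Lemma trail_edge_cut i : i < n -> exists u v (S : {set T}) (b : E + T),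
  [/\ R_biconnected u v, u \in S, v \notin S & b \in elements E Q u v] /\
  [/\ w i \notin S, w i.+1 \in S
    & {in cut_edges ends G S, forall g, g = ed i \/ hits ends b g}].
Proof.
move=> iN.
have [u [v [S [B [uR vR + eS [BQ ltB cutS]]]]]] :=
  minimal_edge_tight_cut (ed_edges iN).
wlog [wiS wiS'] : S eS cutS / w i \notin S /\ w i.+1 \in S => [orient|nS].
  move: (eS); rewrite (in_cut_edges _ wfG (ed_edges iN) (ed_ends iN)) => sides.
  have [wiS|wiS] := boolP (w i \in S); rewrite ?wiS ?(negPf wiS) in sides;
    last first.
    by apply: orient; rewrite // -[w i.+1 \in S]negbK; case: (_ \in S) sides.
  move=> nS; apply: (orient (~: S)); rewrite ?cut_edgesC // !inE ?wiS.
    by case: (_ \in S) sides.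
  by rewrite (inj_eq negb_inj).
have {ltB} [B0|[b Bb r2]] : B = set0 \/ exists2 b, B = [set b] & 2 <= r u v.
  have leB : #|B| <= 1 by rewrite -ltnS (leq_trans ltB) // r_le2.
  have [/cards0_eq|B_gt0] := posnP #|B|; [by left | right].
  have /cards1P[b Bb] : #|B| == 1 by rewrite eqn_leq leB.
  by exists b => //; apply: leq_ltn_trans B_gt0 ltB.
- exfalso; have [||k [kN ki /eqP/(ed_inj kN iN) Eki]] :=
    @trail_edge_breaker i S (inl (ed i)) iN wiS wiS'; first by rewrite inE.
    by move=> g /cutS[->|]; [left | rewrite B0 blocks0].
  by rewrite Eki eqxx in ki.
move: cutS BQ; rewrite Bb sub1set => cutS bQ.
have {}cutS : {in cut_edges ends G S, forall g, g = ed i \/ hits ends b g}.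
  by move=> g /cutS; rewrite blocks1.
have conn : R_biconnected u v.
  apply/and3P; split=> //; apply/element_connectedP=> S' B' nS' BQ' ltB'.
  have /element_connectedP := minimal_element_connected uR vR; apply=> //.
  exact: leq_trans ltB' r2.
have [uS|uS] := boolP (u \in S).
  by exists u, v, S, b; rewrite uS in nS; split; split.
exists v, u, S, b; rewrite R_biconnectedC elementsC; split; split=> //.
by move: nS; rewrite (negPf uS); case: (v \in S).
Qed.

Lemma trail_inner_element i u v : 0 < i < n -> R_biconnected u v ->
  w i \in Q :\: [set u; v].
Proof.
move=> /w_inner/setDP[wQ wR] /and3P[uR vR _]; rewrite !inE wQ andbT.
by apply/norP; split; apply: contraNneq wR => ->.
Qed.

(* A breaker that is an edge of the trail may be replaced by its endnode closer
   to ed i. *)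
Lemma trail_edge_tight i : i < n ->
  exists z A u v, [/\ tight (ed i) z A u v, w i \notin A & w i.+1 \in A].
Proof.
move=> iN; have [u [v [S [b [[conn uS vS bQ] [wiS wiS' cutS]]]]]] :=
  trail_edge_cut iN.
have [z zQ {}cutS] : exists2 z, z \in Q :\: [set u; v]
    & {in cut_edges ends G S, forall g, g = ed i \/ z \in ends g}.
  case: b bQ cutS => [f _ cutS|z]; last by rewrite inE; exists z.
  have [|k [kN ki /eqP Ek]] := trail_edge_breaker iN wiS wiS' _ cutS;
    first by rewrite inE.
  case: (ltngtP k i) ki => // [ki|ik] _.
    exists (w k.+1); first by apply: trail_inner_element;
      rewrite ?(leq_ltn_trans ki).
    by move=> g /cutS[->|/eqP->]; [left | right; rewrite -Ek ed_ends // set22].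
  exists (w k); first by apply: trail_inner_element;
    rewrite ?(leq_ltn_trans _ ik).
  by move=> g /cutS[->|/eqP->]; [left | right; rewrite -Ek ed_ends // set21].
have tightS := tight_setD1 conn uS vS zQ cutS.
exists z, (S :\ z), u, v; split=> //;
  rewrite in_setD1 ?wiS' ?andbT ?negb_and ?wiS ?orbT //.
by apply: contraNneq (tight_touch tightS) => <-; rewrite ed_ends // set22.
Qed.

Lemma trail_tight_index i z A u v : i < n -> tight (ed i) z A u v ->
  w i \notin A -> w i.+1 \in A ->
  exists j, [/\ trail_index j, w j = z & (j < i) || (i.+1 < j)].
Proof.
move=> iN tightA wiA wiA'; have ze := tight_touch tightA.
suff [j jP wj] : exists2 j, trail_index j & w j = z.
  exists j; split=> //; move: ze; rewrite ed_ends // -wj.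
  case: (ltngtP j i) => //= [ij|->]; last by rewrite set21.
  by rewrite ltn_neqAle ij andbT; have [<-|//] := eqVneq i.+1 j; rewrite set22.
have n_gt0 := leq_ltn_trans (leq0n i) iN.
have [znend|] := boolP (z \in [set w 0; w n]).
  have nP : trail_index n by rewrite /trail_index leqnn n_gt0.
  have [Ew|nw] := eqVneq (w 0) (w n).
    by exists n => //; move: znend; rewrite Ew setUid => /set1P.
  by case/set2P: znend => ->; [exists 0 | exists n].
case: tightA => -[_ _ _ /setDP[zQ _] _] cutA zend.
have [|k [kN _ /=]] := trail_edge_breaker (b := inr z) iN wiA wiA' _ cutA.
  by rewrite inE in_setD zend.
rewrite ed_ends // => /set2P[] Ez; [exists k | exists k.+1];
  rewrite ?Ez // /trail_index.
  rewrite (ltnW kN) /=; case: (posnP k) => //= k0; move: zend.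
  by rewrite Ez k0 set21.
by rewrite kN.
Qed.

Definition tight_forward i := exists j A u v,
  [/\ trail_index j, i.+1 < j, tight (ed i) (w j) A u v,
    w i \notin A & w i.+1 \in A].

Lemma tight_forward_lt i : tight_forward i -> i.+1 < n.
Proof.
by case=> j [A [u [v [/andP[jn _] ij _ _ _]]]]; apply: leq_trans ij jn.
Qed.

Lemma tight_notin_before i j m A u v : i < n -> trail_index j -> i.+1 < j ->
  tight (ed i) (w j) A u v -> w i \notin A -> trail_index m -> m <= i ->
  w m \notin A.
Proof.
move=> i_n jP ij [_ cutA] wiA mP mi.
rewrite (@trail_side_const A m i) ?(ltnW i_n) // => k /andP[mk ki].
have kn := ltn_trans ki i_n; apply/negP=> /cutA[/(ed_inj kn i_n) Eki|].
  by rewrite Eki ltnn in ki.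
have kj : k.+1 < j by apply: ltn_trans ij.
have kP : trail_index k by apply: trail_index_le mP _; rewrite mk ltnW.
by case/(trail_index_touch jP kP kn)=> Ej;
  rewrite Ej ltnNge ?leqnSn ?leqnn in kj.
Qed.

Lemma tight_in_after i j m A u v : i < n -> trail_index m -> m < i ->
  tight (ed i) (w m) A u v -> w i.+1 \in A -> trail_index j -> i < j ->
  w j \in A.
Proof.
move=> i_n mP mi [_ cutA] wiA /andP[jn _] ij.
rewrite -(@trail_side_const A i.+1 j) // => k /andP[ik kj].
have kn := leq_trans kj jn; apply/negP=> /cutA[/(ed_inj kn i_n) Eki|].
  by rewrite Eki ltnn in ik.
have mk := ltn_trans mi ik.
have kP : trail_index k by apply: trail_index_le mP _; rewrite (ltnW mk) ltnW.
by case/(trail_index_touch mP kP kn)=> Em;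
  rewrite Em ltnNge ?leqnSn ?leqnn in mk.
Qed.

Lemma tight_uncross i j m A S u v u' v' :
  trail_index j -> i.+1 < j -> trail_index m -> m <= i ->
  tight (ed i) (w j) A u v -> w i \notin A -> w i.+1 \in A ->
  tight (ed i.+1) (w m) S u' v' -> w i.+1 \notin S -> w i.+2 \in S ->
  [/\ i.+2 < j, tight (ed i.+1) (w j) (A :&: S) u v & w i.+2 \in A].
Proof.
move=> jP ij mP mi tightA wiA wiA' tightS wiS wiS'.
have jn : j <= n by case/andP: jP.
have i1n : i.+1 < n := leq_trans ij jn.
have i_n : i < n := ltnW i1n.
case: (tightA) => -[conn uA vA wjQ wjA] cutA;
  case: (tightS) => -[_ _ _ _ wmS] cutS.
have wmA := tight_notin_before i_n jP ij tightA wiA mP mi.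
have wjS := tight_in_after i1n mP mi tightS wiS' jP ij.
have [ti tf] : w i.+1 \in ends (ed i) /\ w i.+1 \in ends (ed i.+1).
  by rewrite !ed_ends // set21 set22.
have cutI := uncross_setI wfG ti wiA' wiS wmA cutA cutS.
have cutD := uncross_setD wfG ti tf wjA wjS wmA wmS cutA cutS.
have uS : u \in S.
  apply: contraT => uS;
    case: (R_biconnected_unseparated (A := A :\: S) conn _ _ _ cutD).
  - by rewrite in_setD uS.
  - by rewrite in_setD negb_and vA orbT.
  - by apply: trail_inner_element.
have tightI : tight (ed i.+1) (w j) (A :&: S) u v.
  by split=> //; split; rewrite // in_setI ?uA // negb_and ?vA ?wjA.
have ij' : i.+2 < j.
  rewrite ltn_neqAle ij andbT; apply/eqP=> Ej.
  by have := tight_touch tightI; rewrite ed_ends // -Ej set22.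
split=> //; apply: contraT => wA; have [|/(ed_inj i1n i_n)|] := cutA (ed i.+1).
- by rewrite (in_cut_edges _ wfG (ed_edges i1n) (ed_ends i1n)) wiA' (negPf wA).
- by move/eqP; rewrite gtn_eqF.
- have i1P : trail_index i.+1 by rewrite /trail_index ltnW.
  by case/(trail_index_touch jP i1P i1n)=> Ej; rewrite Ej ltnn // in ij ij'.
Qed.

Lemma tight_forwardS i : tight_forward i -> tight_forward i.+1.
Proof.
move=> fi; have i1n := tight_forward_lt fi.
case: fi => j [A [u [v [jP ij tightA wiA wiA']]]].
have [z [S [u' [v' [tightS wiS wiS']]]]] := trail_edge_tight i1n.
have [m [mP wm /orP[mi|im]]] := trail_tight_index i1n tightS wiS wiS';
  rewrite -wm in tightS.
  have [ij' tightI wA] :=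
    tight_uncross jP ij mP mi tightA wiA wiA' tightS wiS wiS'.
  by exists j, (A :&: S), u, v; rewrite !in_setI wA wiS' (negPf wiS) andbF.
by exists m, S, u', v'.
Qed.

Lemma trail_length0 : n = 0.
Proof.
apply/eqP; rewrite -leqn0 leqNgt; apply/negP=> n_gt0.
suff fwd i : tight_forward i
  by have := tight_forward_lt (fwd n); rewrite ltnNge leqnSn.
elim: i => [|i IH]; last exact: tight_forwardS.
have [z [A [u [v [tightA w0A w1A]]]]] := trail_edge_tight n_gt0.
have [j [jP wj /orP[//|j_gt1]]] := trail_tight_index n_gt0 tightA w0A w1A.
by exists j, A, u, v; split=> //; rewrite wj.
Qed.

End Trail.

Lemma no_connected_trail x p : walk ends G x p -> uniq (unzip1 p) ->
  uniq (unzip2 p) -> uniq (belast x (unzip2 p)) ->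
  {subset behead (belast x (unzip2 p)) <= Q :\: R} ->
  {in unzip1 p, forall e,
     element_connected ends Q 2 (delete_edge G e) x (last x (unzip2 p))} ->
  p = [::].
Proof.
move=> wp u1 u2 ub pQR conn; case Ep: p => [//|[e0 y] p']; apply: size0nil.
rewrite -Ep; pose s := unzip2 p.
have sz1 : size (unzip1 p) = size p by rewrite size_map.
have sz2 : size s = size p by rewrite size_map.
have szb : size (belast x s) = size p by rewrite size_belast.
have nth_belast i : i < size p -> nth x (x :: s) i = nth x (belast x s) i.
  by move=> ip; rewrite lastI nth_rcons szb ip.
apply: (@trail_length0 (nth x (x :: s)) (nth e0 (unzip1 p)))
  => [i ip|i ip|i j ip jp|i j|i|i ip].
- by apply: (walk_edges wp); rewrite mem_nth ?sz1.
- exact: (walk_nth e0 wp ip).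
- by move/eqP; rewrite nth_uniq ?sz1 // => /eqP.
- case/andP=> ij jp /orP[i_gt0|jp']; last first.
    by rewrite !nth_belast ?(ltn_trans ij) // nth_uniq ?szb ?(ltn_trans ij) //
      ltn_eqF.
  case: i j ij jp i_gt0 => // i [//|j]; rewrite ltnS => ij jp _ /=.
  by rewrite nth_uniq ?sz2 ?(ltn_trans ij) // ltn_eqF.
- case/andP=> i_gt0 ip; apply: pQR;
    rewrite nth_belast // -(prednK i_gt0) -nth_behead.
  by rewrite mem_nth // size_behead szb -ltnS !prednK // (leq_trans _ ip).
- have -> : nth x (x :: s) (size p) = last x s by rewrite -sz2 (last_nth x).
  by apply: conn; rewrite mem_nth ?sz1.
Qed.

Lemma no_cycle_with_one_exception x p :
  {in unzip2 p, forall y, y != x -> y \in Q :\: R} -> ~~ is_cycle ends G x p.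
Proof.
move=> pQR; apply/negP=> /and5P[/eqP p0 wp /eqP lp u1 u2]; apply: p0.
have perm_belast : perm_eq (belast x (unzip2 p)) (unzip2 p).
  by rewrite -(perm_cons x) perm_sym lastI lp perm_rcons.
have ub : uniq (belast x (unzip2 p)) by rewrite (perm_uniq perm_belast).
apply: (no_connected_trail wp u1 u2 ub) => [y yb|e _]; last first.
  by rewrite lp element_connected_refl.
apply: pQR; first by rewrite -(perm_mem perm_belast) mem_behead.
by apply: contraTneq yb => ->; move: ub; case: (unzip2 p) => //= z s /andP[].
Qed.

(* The shortest link between the two paths has all its edges off them, so that
   its endnodes stay 2-connected when one of these is deleted. *)
Lemma no_link_between_disjoint_paths u v p q x s :
  is_uvpath ends G u v p -> is_uvpath ends G u v q -> Qdisjoint Q u v p q ->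
  walk ends G x s -> uniq (x :: unzip2 s) ->
  {subset x :: unzip2 s <= Q :\: [set u; v]} ->
  {in unzip2 s, forall y, y \notin R} -> x \in unzip2 p ->
  last x (unzip2 s) \in unzip2 q ->
  False.
Proof.
move=> pP qP dis ws us sQ sR xp lq.
have [y [t [wt ut sub [yp tp] [lt tq]]]] :=
  subwalk_between (A := [in unzip2 p]) (B := [in unzip2 q]) wfG ws us xp lq.
have tQ z : z \in y :: unzip2 t -> z \in Q :\: [set u; v] by move/sub/sQ.
have ut' : u \notin y :: unzip2 t by apply/negP=> /tQ; rewrite !inE eqxx.
have t_off_p e : e \in unzip1 t -> e \notin unzip1 p.
  apply: (walk_edge_off_uvpath wfG pP wt ut' (z0 := y)) => // z;
    rewrite inE => /predU1P[//|/tp] /= nzp zp.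
  by rewrite zp in nzp.
have t_off_q e : e \in unzip1 t -> e \notin unzip1 q.
  apply: (walk_edge_off_uvpath wfG qP wt ut' (z0 := last y (unzip2 t))) => // z.
  rewrite lastI mem_rcons inE => /predU1P[//|/tq] /= nzq zq.
  by rewrite zq in nzq.
have t0 : t = [::].
  have ut2 : uniq (unzip2 t) by case/andP: ut.
  have utb : uniq (belast y (unzip2 t))
    by move: ut; rewrite lastI rcons_uniq => /andP[].
  apply: (no_connected_trail wt _ ut2 utb) => [|z zt|e et].
  - have tP : is_uvpath ends G y (last y (unzip2 t)) t by apply/and3P.
    exact: uvpath_uniq_edges tP.
  - have {}zt : z \in unzip2 t by case: (unzip2 t) zt => //= z' t' /mem_belast.
    have /setDP[zQ _] := tQ z (mem_behead (s := y :: _) zt).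
    rewrite in_setD zQ andbT; have := sub z (mem_behead (s := y :: _) zt).
    rewrite inE => /predU1P[zx|/sR//]; by have := tp z zt; rewrite zx /= xp.
  - have not_v z : z \in y :: unzip2 t -> z != v.
      by move/tQ; rewrite !inE negb_or -andbA => /and3P[].
    apply: (disjoint_paths_connected (wf_delete_edge e wfG)
      (uvpath_delete_edge (t_off_p e et) pP)
        (uvpath_delete_edge (t_off_q e et) qP)
      dis yp lt); by rewrite not_v ?mem_head ?mem_last.
move: lt; rewrite t0 /= => yq.
have := Qdisjoint_nodes dis (tQ y (mem_head _ _)) yp.
by rewrite yq.
Qed.

Hypothesis QRV : Q :|: R = nodes G.

Section MinimalComponent.

Variable C : {set T}.
Hypothesis compC : C \in components ends (graphD ends G R).

Local Notation K := (Rcomponent ends G C).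

Lemma component_QR c : c \in C -> c \in Q :\: R.
Proof.
move/(subsetP (component_sub compC)); rewrite -QRV !inE.
by case/andP=> /negPf-> /orP[].
Qed.

Lemma component_element u v c : u \in R -> v \in R -> c \in C ->
  c \in Q :\: [set u; v].
Proof.
move=> uR vR /component_QR/setDP[cQ cR]; rewrite !inE cQ andbT.
by apply/norP; split; apply: contraNneq cR => ->.
Qed.

Lemma Rcomponent_walk x p : walk ends K x p -> walk ends G x p.
Proof.
move=> wp; apply: (walk_transfer _ _ wp).
  by move=> e /(walk_edges wp);
    apply: (subsetP (Rcomponent_edges_sub ends G C)).
have := walk_last wp;
  rewrite in_setU => /orP[/(subsetP (component_sub compC))/setDP[]//|].
by rewrite inE => /andP[/setDP[]].
Qed.

(* Two such edges would close a cycle through C with y as its only other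
   node. *)
Lemma neighbor_edge_uniq y c d e f : y \notin C -> c \in C -> d \in C ->
  e \in edges G -> f \in edges G -> ends e = [set y; c] ->
  ends f = [set d; y] ->
  e = f.
Proof.
move=> yC cC dC eG fG eyc fdy; apply/eqP; apply: contraT => nef.
have [p /and3P[/Rcomponent_walk wp /eqP lp up] pC] :=
  component_uvpath wfG compC cC dC.
have off g : y \in ends g -> g \notin unzip1 p.
  by move=> yg; apply: contra yC => gp; apply: pC; apply: walk_ends wp gp yg.
have ye : y \in ends e by rewrite eyc set21.
have yf : y \in ends f by rewrite fdy set22.
suff: ~~ is_cycle ends G y (rcons ((e, c) :: p) (f, y)).
  have /uvpath_uniq_edges uE : is_uvpath ends G c d p
    by rewrite /is_uvpath wp lp eqxx.
  rewrite /is_cycle /unzip1 /unzip2 !map_rcons last_rcons -/unzip1 -/unzip2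
    !rcons_uniq /=.
  rewrite -cats1 walk_cat // wp lp /= eG fG eyc fdy !eqxx (wf_nodes wfG fG yf).
  rewrite inE negb_or eq_sym nef !off // uE /= => /negP; case; apply/andP;
    split=> //.
  by apply: contra yC; apply: pC.
apply: no_cycle_with_one_exception => z;
  rewrite /unzip2 map_rcons mem_rcons inE -/unzip2.
by move=> /predU1P[->|/pC/component_QR//]; rewrite eqxx.
Qed.

Lemma Rcomponent_acyclic x p : ~~ is_cycle ends K x p.
Proof.
apply/negP=> /and5P[p0 /[dup] wK /Rcomponent_walk wp lp u1 u2].
have pG : is_cycle ends G x p by apply/and5P.
have pK : {subset unzip1 p <= edges K} := walk_edges wK.
have [/hasP[y yp yC]|/hasPn pC] := boolP (has [predC C] (unzip2 p)); last first.
  suff: ~~ is_cycle ends G x p by rewrite pG.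
  by apply: no_cycle_with_one_exception => y /pC;
    rewrite /= negbK => /component_QR.
have [q /and5P[q0 wq /eqP lq uq1 _] qp] := cycle_rot wfG pG yp.
have qK e : e \in unzip1 q -> e \in edges K by move/qp/pK.
case: q q0 wq lq uq1 {qp} qK
  => [//|[e c] q] _ /= /and3P[eG /eqP eyc wq] lq /andP[eq _] qK.
have cC : c \in C.
  by have := qK e (mem_head _ _);
    rewrite (in_Rcomponent_edges C wfG eG eyc) (negPf yC).
case/lastP: q => [|q [f z]] in wq lq eq qK *; first by rewrite -lq /= cC in yC.
move: wq lq eq qK;
  rewrite -cats1 walk_cat // /unzip1 /unzip2 !map_cat !last_cat /=.
move=> /andP[_ /and3P[fG /eqP fdz _]] zy;
  rewrite mem_cat inE negb_or => /andP[_ nef] qK.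
have fK : f \in edges K by apply: qK; rewrite inE mem_cat mem_head !orbT.
have dC : last c (unzip2 q) \in C.
  by move: fK; rewrite (in_Rcomponent_edges C wfG fG fdz) zy (negPf yC) orbF.
rewrite zy in fdz.
by rewrite (neighbor_edge_uniq yC cC dC eG fG eyc fdz) eqxx in nef.
Qed.

Lemma Rcomponent_tree : is_tree ends K.
Proof.
by split; [apply: (Rcomponent_connected wfG compC) | apply: Rcomponent_acyclic].
Qed.

Lemma Rcomponent_meets_one_path u v p q x c : u \in R -> v \in R ->
  is_uvpath ends G u v p -> is_uvpath ends G u v q -> Qdisjoint Q u v p q ->
  x \in nodes K -> x \in Q :\: [set u; v] -> x \in unzip2 p ->
  c \in C -> c \notin unzip2 q.
Proof.
move=> uR vR pP qP dis xK xQ xp cC; apply/negP=> cq.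
have [s /and3P[/Rcomponent_walk ws /eqP ls us] sC] :=
  Rcomponent_uvpath wfG compC xK cC.
apply: (no_link_between_disjoint_paths pP qP dis ws us); rewrite ?ls //.
  move=> y; rewrite inE => /predU1P[->//|/sC]; exact: component_element.
by move=> y /sC; apply: (component_notR compC).
Qed.

End MinimalComponent.

Hypothesis r_sym : {in R &, forall u v, r u v = r v u}.

(** * Replacing R-components by cycles *)

Section Replacement.

Variables (CC : {set {set T}}) (s : {set T} -> seq T).
Hypothesis CC_components : CC \subset components ends (graphD ends G R).
Hypothesis s_uniq : {in CC, forall C, uniq (s C)}.
Hypothesis s_mem : {in CC, forall C, s C =i neighbors ends G C}.

Variables Y Yp : {set T}.
Hypotheses (YYp : Y \subset Yp) (YpV : Yp \subset nodes G :\: cover CC).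

Local Notation kept := (nodes G :\: cover CC).
Local Notation L C := (neighbors ends G C).

Definition covered : {set repl_edge T E} :=
  [set e in edges (repl_graph ends G CC)
    | covers kept Y Yp (repl_ends ends s e)].

Definition capacity : rat := (\sum_(e in covered) repl_cap e)%R.

(* The replaced graph is split into objects: single edges of G, and cycles. *)
Definition object (e : repl_edge T E) : E + {set T} :=
  match e with inl e0 => inl e0 | inr (C, _) => inr C end.

Definition weight (o : E + {set T}) : rat :=
  (\sum_(e in covered | object e == o) repl_cap e)%R.

Definition crosses (o : E + {set T}) : Prop :=
  match o with
  | inl e => inl e \in covered
  | inr C => [/\ C \in CC, exists2 a, a \in L C & a \in Y
               & exists2 b, b \in L C & b \in kept :\: Yp]
  end.

Definition seen_by (p : seq (E * T)) (o : E + {set T}) : Prop :=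
  match o with
  | inl e => e \in unzip1 p
  | inr C => exists2 c, c \in C & c \in unzip2 p
  end.

Lemma CC_component C : C \in CC -> C \in components ends (graphD ends G R).
Proof. exact: (subsetP CC_components). Qed.

Lemma replaced_notin_kept C x : C \in CC -> x \in C -> x \notin kept.
Proof.
move=> CCC xC; rewrite in_setD negb_and negbK; apply/orP; left.
by apply/bigcupP; exists C.
Qed.

Lemma R_kept x : x \in R -> x \in kept.
Proof.
move=> xR; rewrite in_setD (subsetP RV) // andbT; apply/bigcupP=> -[C CCC xC].
by have := component_notR (CC_component CCC) xC; rewrite xR.
Qed.

Lemma neighbors_kept C x : C \in CC -> x \in L C -> x \in kept.
Proof. by move=> /CC_component Cc /(neighbors_R wfG Cc)/R_kept. Qed.

Lemma Y_kept x : x \in Y -> x \in kept.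
Proof. by move/(subsetP YYp)/(subsetP YpV). Qed.

Lemma Yp_off_boundary x : x \notin Yp :\: Y -> (x \in Yp) = (x \in Y).
Proof.
by rewrite in_setD; have [xY _|_ /negPf] := boolP (x \in Y);
  first exact: (subsetP YYp).
Qed.

Lemma outside_off_boundary x : x \in kept -> x \notin Y -> x \notin Yp :\: Y ->
  x \in kept :\: Yp.
Proof. by move=> xV xY xb; rewrite in_setD Yp_off_boundary ?xY. Qed.

Lemma coversP S :
  reflect (exists x y, [/\ x \in Y, y \in kept :\: Yp & S = [set x; y]])
  (covers kept Y Yp S).
Proof.
apply: (iffP exists_inP)
  => [[x xY /exists_inP[y yV /eqP->]]|[x [y [xY yV ->]]]].
  by exists x, y.
by exists x => //; apply/exists_inP; exists y.
Qed.

Lemma edge_covered e x y : e \in edges G -> ends e = [set x; y] -> x \in Y ->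
  y \in kept :\: Yp -> inl e \in covered.
Proof.
move=> eG exy xY yV; rewrite inE; apply/andP; split;
  last by apply/coversP; exists x, y.
rewrite inE eG; apply/forall_inP=> C CCC;
  rewrite (in_Rcomponent_edges C wfG eG exy).
case/setDP: yV => yV _; rewrite negb_or.
have off_C z : z \in kept -> z \notin C := contraL (replaced_notin_kept CCC).
by rewrite off_C ?Y_kept // off_C.
Qed.

Lemma cycle_edge_covered C x : C \in CC -> x \in L C ->
  (x \in Y) && (next (s C) x \notin Yp)
    || (x \notin Yp) && (next (s C) x \in Y) ->
  inr (C, x) \in covered.
Proof.
move=> CCC xL sides;
  have nxL : next (s C) x \in L C by rewrite -s_mem // mem_next s_mem.
rewrite inE; apply/andP; split; first by rewrite inE CCC.
apply/coversP; case/orP: sides => /andP[xs ns].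
  by exists x, (next (s C) x); rewrite in_setD ns (neighbors_kept CCC).
by exists (next (s C) x), x; rewrite in_setD xs (neighbors_kept CCC) // setUC.
Qed.

Lemma cycle_exit C (P : pred T) a b : C \in CC -> a \in L C -> b \in L C ->
  P a -> ~~ P b ->
  exists x, [/\ x \in L C, next (s C) x \in L C, P x & ~~ P (next (s C) x)].
Proof.
move=> CCC; rewrite -!s_mem // => aC bC Pa nPb.
have [x [xC Px nPx]] := next_exit (s_uniq CCC) aC bC Pa nPb.
by exists x; rewrite -!s_mem // mem_next.
Qed.

Local Open Scope ring_scope.

Lemma repl_cap_ge0 (e : repl_edge T E) : 0 <= repl_cap e.
Proof. by case: e. Qed.

Lemma weight_ge0 o : 0 <= weight o.
Proof. by apply: sumr_ge0 => e _; apply: repl_cap_ge0. Qed.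

Lemma capacity_ge0 : 0 <= capacity.
Proof. by apply: sumr_ge0 => e _; apply: repl_cap_ge0. Qed.

Lemma capacity_ge_weights (O : {set E + {set T}}) :
  \sum_(o in O) weight o <= capacity.
Proof.
rewrite /capacity (partition_big object predT) //=.
by apply: (ler_sum_sub (B := predT)) => // o; apply: weight_ge0.
Qed.

Lemma weight_ge_caps (A : {set repl_edge T E}) o : A \subset covered ->
  {in A, forall e, object e = o} -> \sum_(e in A) repl_cap e <= weight o.
Proof.
move=> Acov Ao;
  apply: (ler_sum_sub (B := [pred e in covered | object e == o])) => e.
  by move=> eA; apply/andP; split; [apply: (subsetP Acov) | apply/eqP/Ao].
exact: repl_cap_ge0.
Qed.

Lemma weight_ge_cap e : e \in covered -> repl_cap e <= weight (object e).
Proof.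
move=> ecov; rewrite -(big_set1 +%R e (@repl_cap T E)).
by apply: weight_ge_caps; [rewrite sub1set | move=> f /set1P->].
Qed.

Lemma weight_cycle C : crosses (inr C) -> [disjoint L C & Yp :\: Y] ->
  1 <= weight (inr C).
Proof.
case=> CCC [a aL aY] [b bL /setDP[bV bYp]] dis.
have in_Y x : x \in L C -> (x \in Yp) = (x \in Y).
  by move=> xL; rewrite Yp_off_boundary // (disjointFr dis).
have bY : b \notin Y by rewrite -in_Y.
have [x [xL nxL xY nxY]] := cycle_exit (P := [in Y]) CCC aL bL aY bY.
have [||y [yL nyL yY nyY]] := cycle_exit (P := [predC Y]) CCC bL aL.
- by [].
- by rewrite /= negbK.
rewrite /= negbK in yY nyY nxY xY.
have nxy : inr (C, x) != inr (C, y) :> repl_edge T E.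
  by apply: contraNneq yY => -[<-].
pose exits : {set repl_edge T E} := [set inr (C, x); inr (C, y)].
rewrite (_ : 1 = \sum_(e in exits) repl_cap e); last first.
  by rewrite big_setU1 ?inE //= big_set1.
apply: weight_ge_caps => [|e /set2P[]->//]; rewrite subUset !sub1set.
by rewrite !cycle_edge_covered // !in_Y // ?xY ?nxY ?yY ?nyY ?orbT.
Qed.

Lemma weight_cycle_half C z : crosses (inr C) -> Yp :\: Y = [set z] ->
  1 / 2%:R <= weight (inr C).
Proof.
case=> CCC [a aL aY] [b bL /setDP[bV bYp]] Ez.
have in_Y x : x != z -> (x \in Yp) = (x \in Y).
  by move=> xz; rewrite Yp_off_boundary // Ez inE.
have bY : b \notin Y by apply: contra bYp; apply: (subsetP YYp).
have aYp : a \in Yp by apply: (subsetP YYp).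
have [x [xL nxL xY nxY]] := cycle_exit (P := [in Y]) CCC aL bL aY bY.
have [||y [yL nyL yYp nyYp]] := cycle_exit (P := [predC Yp]) CCC bL aL.
- by [].
- by rewrite /= negbK.
rewrite /= negbK in yYp nyYp nxY xY.
have [Ex|nxz] := eqVneq (next (s C) x) z; last first.
  apply: (@weight_ge_cap (inr (C, x))); apply: cycle_edge_covered => //.
  by rewrite xY in_Y // nxY.
apply: (@weight_ge_cap (inr (C, y))); apply: cycle_edge_covered => //.
rewrite yYp -in_Y ?nyYp ?orbT //; apply: contraNneq yYp => Ey.
suff -> : y = x by apply: (subsetP YYp).
by apply: (can_inj (prev_next (s_uniq CCC))); rewrite Ex Ey.
Qed.

Lemma weight_ge1 o : crosses o ->
  (forall C, o = inr C -> [disjoint L C & Yp :\: Y]) ->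
  1 <= weight o.
Proof.
case: o => [e eC _|C oC dis]; first exact: (weight_ge_cap eC).
exact: weight_cycle (dis C erefl).
Qed.

Lemma weight_ge_half o z : crosses o -> Yp :\: Y = [set z] ->
  1 / 2%:R <= weight o.
Proof.
case: o => [e eC _|C oC Ez]; last exact: weight_cycle_half Ez.
exact: le_trans (weight_ge_cap eC).
Qed.

Definition avoids_boundary (p : seq (E * T)) : bool :=
  all [predC Yp :\: Y] (unzip2 p).

Definition shore : {set T} :=
  Y :|: \bigcup_(C in CC | ~~ [disjoint L C & Y]) C.

Lemma sub_shore C c y : C \in CC -> c \in C -> y \in L C -> y \in Y ->
  c \in shore.
Proof.
move=> CCC cC yL yY; rewrite inE; apply/orP; right; apply/bigcupP;
  exists C => //.
by rewrite CCC; apply/pred0Pn; exists y; rewrite /= yL.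
Qed.

Lemma shoreP x : reflect (x \in Y \/ exists C, [/\ C \in CC, x \in C
    & exists2 a, a \in L C & a \in Y]) (x \in shore).
Proof.
rewrite in_setU; apply: (iffP orP) => -[xY|]; [by left| |by left|].
  by case/bigcupP=> C /andP[CCC /pred0Pn[a /andP[aL aY]]] xC; right; exists C;
    split=> //; exists a.
case=> C [CCC xC [a aL aY]]; right; have := sub_shore CCC xC aL aY.
rewrite in_setU => /orP[xY|//].
by have := replaced_notin_kept CCC xC; rewrite Y_kept.
Qed.

(* The path leaves the shore along an edge that is kept, or from a component in
   CC to one of its neighbors. *)
Lemma uvpath_crosses u v p : is_uvpath ends G u v p -> u \in Y ->
  v \in kept :\: Yp ->
  avoids_boundary p -> exists2 o, crosses o & seen_by p o.
Proof.
move=> /and3P[wp /eqP lp _] uY /setDP[vV vYp] /allP pb.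
have off x : x \in u :: unzip2 p -> x \notin Yp :\: Y.
  by rewrite inE => /predU1P[->|/pb//]; rewrite in_setD uY.
have vS : v \notin shore.
  apply/shoreP=> -[vY|[C [CCC vC _]]]; first by rewrite (subsetP YYp) in vYp.
  by have := replaced_notin_kept CCC vC; rewrite vV.
have uS : u \in shore by apply/shoreP; left.
have [|g gp /(cut_ends wfG)[x [y [gG gxy xS yS]]]] :=
  walk_cut (S := shore) wfG wp.
  by rewrite lp uS (negPf vS).
have [xp yp] : x \in u :: unzip2 p /\ y \in u :: unzip2 p.
  by split; apply: (walk_ends wp gp); rewrite gxy ?set21 ?set22.
have xy : adj ends G x y by apply/adjP; exists g.
have yY : y \notin Y by apply: contra yS => yY; apply/shoreP; left.
have y_out : y \in kept -> y \in kept :\: Yp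
  by move/outside_off_boundary; apply=> //; apply: off.
case/shoreP: xS => [xY|[C [CCC xC aL]]].
  exists (inl g) => //; apply: (edge_covered gG gxy xY); apply: y_out.
  rewrite in_setD (wf_nodes wfG gG) ?gxy ?set22 // andbT.
  apply: contra yS => /bigcupP[C CCC yC]; apply: (sub_shore CCC yC _ xY).
  by apply: (adj_neighbors wfG yC);
    rewrite 1?adj_sym // (contraL (replaced_notin_kept CCC)) ?Y_kept.
have yC : y \notin C.
  by apply: contra yS => yC; apply/shoreP; right; exists C.
have yL := adj_neighbors wfG xC xy yC.
exists (inr C).
  by split=> //; exists y => //; apply: y_out; apply: neighbors_kept yL.
exists x => //; move: xp; rewrite inE => /predU1P[xu|//].
by have := replaced_notin_kept CCC xC; rewrite xu Y_kept.
Qed.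

Lemma objects_differ u v p q o o' : u \in R -> v \in R ->
  is_uvpath ends G u v p -> is_uvpath ends G u v q -> Qdisjoint Q u v p q ->
  crosses o -> seen_by p o -> seen_by q o' -> o != o'.
Proof.
move=> uR vR pP qP dis + po qo'; apply: contraPneq => Eo;
  rewrite -{o'}Eo in qo'.
case: o po qo' => [e ep eq _|C [c cC cp] [d dC dq] [/CC_component Cc _ _]].
  by have := Qdisjoint_edges dis ep; rewrite eq.
have cK : c \in nodes (Rcomponent ends G C) by rewrite in_setU cC.
have := Rcomponent_meets_one_path Cc uR vR pP qP dis cK
  (component_element Cc uR vR cC) cp dC.
by rewrite dq.
Qed.

Lemma capacity_ge_paths u v P (k : rat) : u \in R -> v \in R -> u \in Y ->
  v \in kept :\: Yp -> path_system ends Q G u v P ->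
  {in P, forall p : {bseq #|T| of E * T}, avoids_boundary p} ->
  (forall o, crosses o -> k <= weight o) -> k *+ #|P| <= capacity.
Proof.
move=> uR vR uY vV /path_systemP[pathsP disP] avoidP k_le.
have /fin_all_exists[o oP] (p : {bseq #|T| of E * T}) :
    exists o, p \in P -> crosses o /\ seen_by p o.
  have [pP|] := boolP (p \in P); last by exists (inr set0).
  by have [o co po] := uvpath_crosses (pathsP p pP) uY vV (avoidP p pP);
    exists o.
have o_inj : {in P &, injective o}.
  move=> p q pP qP Eo; apply/eqP; apply: contraT => npq.
  have [[co po] [_ qo]] := (oP p pP, oP q qP).
  have := objects_differ uR vR (pathsP p pP) (pathsP q qP) (disP p q pP qP npq)
    co po qo.
  by rewrite Eo eqxx.
apply: le_trans (capacity_ge_weights (o @: P));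
  rewrite big_imset //= -sumr_const.
by apply: ler_sum => p pP; apply: k_le; case: (oP p pP).
Qed.

Lemma capacity_ge_object o : weight o <= capacity.
Proof. by have := capacity_ge_weights [set o]; rewrite big_set1. Qed.

Lemma capacity_empty_boundary u v P : u \in R -> v \in R -> u \in Y ->
  v \in kept :\: Yp ->
  path_system ends Q G u v P -> Yp :\: Y = set0 -> #|P|%:R <= capacity.
Proof.
move=> uR vR uY vV sysP b0;
  apply: (capacity_ge_paths uR vR uY vV sysP) => [p _|o co].
  by apply/allP=> y _; rewrite /= b0 inE.
by apply: weight_ge1 co _ => C _; rewrite b0 disjoint_sym -setI_eq0 set0I.
Qed.

Lemma weight_avoiding_path u v p q o z : u \in R -> v \in R ->
  is_uvpath ends G u v p -> is_uvpath ends G u v q -> Qdisjoint Q u v p q ->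
  Yp :\: Y = [set z] -> z \in Q :\: [set u; v] -> z \in unzip2 p ->
  crosses o -> seen_by q o -> 1 <= weight o.
Proof.
move=> uR vR pP qP dis Ez zQ zp co qo; apply: weight_ge1 (co) _ => C Eo.
rewrite Ez disjoint_sym disjoints1; move: co qo;
  rewrite Eo => -[/CC_component Cc _ _] [c cC cq].
apply: contraL cq => zL.
apply: (Rcomponent_meets_one_path Cc uR vR pP qP dis _ zQ zp cC).
by rewrite in_setU zL orbT.
Qed.

Lemma capacity_singleton_boundary u v P z : u \in R -> v \in R -> u \in Y ->
  v \in kept :\: Yp -> path_system ends Q G u v P -> (1 < #|P|)%N ->
  Yp :\: Y = [set z] -> z \in Q :\: [set u; v] -> 1 <= capacity.
Proof.
move=> uR vR uY vV sysP P_gt1 Ez zQ;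
  have [pathsP disP] := path_systemP _ _ _ _ _ _ sysP.
have [avoidP|] :=
  boolP [forall p in P, avoids_boundary (p : {bseq #|T| of E * T})].
  apply: le_trans (capacity_ge_paths (k := 1 / 2%:R) uR vR uY vV sysP _ _).
  - by rewrite [leLHS]splitr -mulr2n ler_wpMn2l.
  - by move=> p pP; apply: (forall_inP avoidP).
  - by move=> o co; apply: weight_ge_half co Ez.
rewrite negb_forall_in => /exists_inP[p pP /allPn[y yp]];
  rewrite /= negbK Ez => /set1P Ey.
rewrite {y}Ey in yp; have /set0Pn[q /setD1P[nqp qP]] : P :\ p != set0.
  by rewrite -card_gt0 -ltnS; move: P_gt1; rewrite (cardsD1 p) pP.
have dis : Qdisjoint Q u v p q by apply: disP; rewrite // eq_sym.
have avoid_q : avoids_boundary q.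
  apply/allP=> y yq; rewrite /= Ez inE; apply: contraTneq yq => ->.
  exact: (Qdisjoint_nodes dis zQ yp).
have [o co qo] := uvpath_crosses (pathsP q qP) uY vV avoid_q.
apply: le_trans (capacity_ge_object o).
exact: (weight_avoiding_path uR vR (pathsP p pP) (pathsP q qP) dis Ez zQ yp co
  qo).
Qed.

Lemma cut_pair_capacity u v : u \in R -> v \in R -> u \in Y ->
  v \in kept :\: Yp ->
  Yp :\: Y \subset Q -> (r u v)%:R - #|Yp :\: Y|%:R <= capacity.
Proof.
move=> uR vR uY vV bQ; have vYp : v \notin Yp by case/setDP: vV.
have [r_le|r_gt] := leqP (r u v) #|Yp :\: Y|.
  by apply: le_trans capacity_ge0; rewrite subr_le0 ler_nat.
have nuv : u != v by apply: contraNneq vYp => <-; apply: (subsetP YYp).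
have r_gt0 : (0 < r u v)%N by apply: leq_ltn_trans r_gt.
have /Qlambda_geP[P sysP leP] := minG.1 u v uR vR nuv r_gt0.
have [b0|b_gt0] := posnP #|Yp :\: Y|.
  rewrite b0 subr0;
    apply: le_trans (capacity_empty_boundary uR vR uY vV sysP _).
    by rewrite ler_nat.
  exact: cards0_eq.
have r_le := r_le2 uR vR.
have b1 : #|Yp :\: Y| == 1%N by rewrite eqn_leq b_gt0 -ltnS (leq_trans r_gt).
have /cards1P[z Ez] := b1.
apply: le_trans (capacity_singleton_boundary uR vR uY vV sysP _ Ez _).
- by rewrite (eqP b1) lerBlDr -(natrD _ 1 1) ler_nat.
- by apply: leq_trans leP; rewrite -(eqP b1).
have zb : z \in Yp :\: Y by rewrite Ez set11.
rewrite in_setD (subsetP bQ) // andbT !inE negb_or.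
apply/andP; split; apply: contraTneq zb => ->; first by rewrite in_setD uY.
by rewrite in_setD negb_and vYp orbT.
Qed.

Lemma biset_max_pair : (0 < biset_max r R kept Y Yp)%N ->
  exists u v, [/\ u \in R, v \in R, u \in Y, v \in kept :\: Yp
                & biset_max r R kept Y Yp = r u v].
Proof.
pose sep := [pred uv : T * T | [&& uv.1 \in R, uv.2 \in R,
  covers kept Y Yp [set uv.1; uv.2] & (0 < r uv.1 uv.2)%N]].
have -> : biset_max r R kept Y Yp = (\max_(uv in sep) r uv.1 uv.2)%N by [].
have [uv0 uv0P|none] := pickP sep; last by rewrite big_pred0.
have [|[u v] uvP ->] := eq_bigmax_cond (A := sep) (fun uv => r uv.1 uv.2).
  by apply/card_gt0P; exists uv0.
have /and4P[/= uR vR /coversP[x [y [xY yV Exy]]] _] := uvP => _.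
have nxy : x != y.
  by apply: contraTneq yV => <-; rewrite in_setD (subsetP YYp).
have := set21 x y; have := set22 x y; rewrite -Exy => /set2P[] Ey /set2P[] Ex.
- by rewrite Ex Ey eqxx in nxy.
- by exists x, y; rewrite xY yV Ex Ey; split=> //; rewrite r_sym.
- by exists x, y; rewrite xY yV Ex Ey.
- by rewrite Ex Ey eqxx in nxy.
Qed.

Lemma biset_capacity : biset_req r R Q kept Y Yp <= capacity.
Proof.
rewrite /biset_req; case: ifP => [bQ|_]; last exact: capacity_ge0.
have [->|/biset_max_pair[u [v [uR vR uY vV ->]]]] :=
  posnP (biset_max r R kept Y Yp).
  by rewrite sub0r (le_trans _ capacity_ge0) // oppr_le0 ler0n.
exact: cut_pair_capacity.
Qed.

End Replacement.

End Minimal.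

Lemma dfs_cycle_uniq (T E : finType) (ends : E -> {set T}) (K : graph T E)
    (L : {set T}) s : dfs_cycle ends K L s -> uniq s.
Proof.
by case=> g [root [_ _ ->]]; rewrite filter_uniq // rev_uniq dfs_uniq.
Qed.

Lemma dfs_cycle_mem (T E : finType) (ends : E -> {set T}) (K : graph T E)
    (L : {set T}) s : connected ends K -> L \subset nodes K ->
  dfs_cycle ends K L s -> s =i L.
Proof.
move=> [_ conK] /subsetP LK [g [root [gE rootK ->]]] x.
rewrite mem_filter mem_rev; have [xL|//] := boolP (x \in L).
have /connectP[p pp lp] := conK _ _ rootK (LK _ xL).
apply/dfsP; exists p => //; rewrite -(eq_path (e := adj ends K)) // => a b.
by rewrite /= gE.
Qed.

Theorem theorem5 (T E : finType) (ends : E -> {set T}) (G : graph T E)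
    (R Q : {set T}) (r : T -> T -> nat)
    (wfG : well_formed ends G)
    (RV : R \subset nodes G) (QV : Q \subset nodes G)
    (QRV : Q :|: R = nodes G)
    (r_sym : forall u v, u \in R -> v \in R -> r u v = r v u)
    (r_012 : forall u v, u \in R -> v \in R -> r u v \in [:: 0; 1; 2])
    (minG : minimally_rQ_connected ends r R Q G) :
  (forall C, C \in components ends (graphD ends G R) ->
     is_tree ends (Rcomponent ends G C)) /\
  (forall (CC : {set {set T}}) (s : {set T} -> seq T),
     CC \subset components ends (graphD ends G R) ->
     (forall C, C \in CC ->
        dfs_cycle ends (Rcomponent ends G C) (neighbors ends G C) (s C)) ->
     frac_rQ_connected (repl_ends ends s) (@repl_cap T E) r R Q
       (repl_graph ends G CC)).
Proof.
have r_le2 : {in R &, forall u v, r u v <= 2}.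
  by move=> u v uR vR; have := r_012 u v uR vR; rewrite !inE => /or3P[]/eqP->.
have tree C := Rcomponent_tree wfG RV minG r_le2 QRV (C := C).
split=> // CC s sCC dfs_s; split=> [[e|[C x]] _ //|Y Yp YYp YpV].
have s_uniq : {in CC, forall C, uniq (s C)} by move=> C /dfs_s/dfs_cycle_uniq.
have s_mem : {in CC, forall C, s C =i neighbors ends G C}.
  move=> C CCC; apply: dfs_cycle_mem (dfs_s C CCC); last exact: subsetUr.
  by have [] := tree C (subsetP sCC C CCC).
have := biset_capacity wfG RV minG r_le2 QRV r_sym sCC s_uniq s_mem YYp YpV.
by rewrite /capacity (eq_bigl _ _ (in_set _)).
Qed.
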